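(* Let $n=3m$ range over odd multiples of three and let $d=\sqrt n/\log n$. There is an absolute constant $\alpha^*\approx23.2\%$ (i.e. $\alpha^*\approx0.232$) such that $$\lim_{n\to\infty}\Pr\Big[f(\mathbf x^{(ab)})=f(\mathbf x^{(bc)})=f(\mathbf x^{(ca)})\;\Big|\;\mathcal E_d\Big]=\alpha^*.$$
   Context: There are three alternatives $a,b,c$ and $n=3m$ voters ($n$ odd). Each voter independently chooses one of the $3!$ rankings of the alternatives uniformly at random. For $(kk')\in\{(ab),(bc),(ca)\}$, $x_i^{(kk')}=1$ if voter $i$ prefers $k$ to $k'$ and $-1$ otherwise, and $\mathbf x^{(kk')}=(x^{(kk')}_1,\dots,x_n^{(kk')})$. The pairwise comparison function $f:\{-1,1\}^n\to\{-1,1\}$ is $$f(x_1,\dots,x_n)=\mathrm{sgn}\Big(\sum_{i=1}^m\mathrm{sgn}(x_{3i-2}+x_{3i-1}+x_{3i})\Big).$$ $\mathcal E_d$ is the event that $\big|\sum_{i=1}^nx_i^{(kk')}\big|\le d$ for each $(kk')\in\{(ab),(bc),(ca)\}$. *)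

(* Defs.v *)
From mathcomp Require Import all_boot all_order all_algebra all_fingroup.
From mathcomp Require Import all_classical all_reals all_analysis.

Set Implicit Arguments.
Unset Strict Implicit.
Unset Printing Implicit Defensive.

Import Order.TTheory GRing.Theory Num.Theory.
Local Open Scope ring_scope.

Definition alternative := 'I_3.
Definition alt_a : alternative := inord 0.
Definition alt_b : alternative := inord 1.
Definition alt_c : alternative := inord 2.

(* A ranking sends each alternative to its position; position 0 is the most
   preferred one. *)
Definition ranking := {perm alternative}.

Definition prefers (r : ranking) (k k' : alternative) : bool := (r k < r k')%N.

Definition profile (n : nat) := {ffun 'I_n -> ranking}.

Definition vote (n : nat) (k k' : alternative) (p : profile n) (i : 'I_n) : int :=
  if prefers (p i) k k' then 1 else -1.

Lemma voter_subproof (m : nat) (i : 'I_m) (j : 'I_3) : (3 * i + j < 3 * m)%N.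
Proof.
by rewrite (@leq_trans (3 * i.+1)) ?leq_mul2l ?ltn_ord // mulnSr ltn_add2l.
Qed.

(* The three members of the i-th group (both indices counted from 0). *)
Definition voter (m : nat) (i : 'I_m) (j : 'I_3) : 'I_(3 * m) :=
  Ordinal (voter_subproof i j).

(* Only used on +-1-valued x and odd m, where no argument of sg vanishes. *)
Definition comparison (m : nat) (x : 'I_(3 * m) -> int) : int :=
  Num.sg (\sum_(i < m)
    Num.sg (x (voter i (inord 0)) + x (voter i (inord 1)) + x (voter i (inord 2)))).

(* The voters' rankings are independent and uniform: the law on profiles is the
   n-fold product of the uniform law on rankings. *)
Definition Pr (R : realType) (n : nat) (A : {set profile n}) : R :=
  \sum_(p in A) \prod_(i < n) (#|{: ranking}|%:R)^-1.

Definition condPr (R : realType) (n : nat) (A B : {set profile n}) : R :=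
  Pr R (A :&: B) / Pr R B.

Definition close_pair (R : realType) (n : nat) (d : R) (k k' : alternative)
    (p : profile n) : bool :=
  `| (\sum_(i < n) vote k k' p i)%:~R | <= d.

Definition close_election (R : realType) (n : nat) (d : R) : {set profile n} :=
  [set p | [&& close_pair d alt_a alt_b p, close_pair d alt_b alt_c p
             & close_pair d alt_c alt_a p]].

Definition all_comparisons_agree (m : nat) : {set profile (3 * m)} :=
  [set p | (comparison (vote alt_a alt_b p) == comparison (vote alt_b alt_c p))
        && (comparison (vote alt_b alt_c p) == comparison (vote alt_c alt_a p))].

Definition closeness (R : realType) (n : nat) : R := Num.sqrt n%:R / ln n%:R.

(* Main.v *)
(** A ranking is encoded by an axis [k], the comparison that differs from the
    two others, and a sign: its three pairwise votes are the coordinates of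
    [+- axis k].  Given the axes, the three margins are then a walk with
    independent signs.  For a group of three votes, twice the majority is the
    sum minus the product, so on a close election each comparison is minus the
    sign of a sum of products, unless that sum is itself small.

    The products of the groups only depend on the axes and on the parities of
    the sign triples, and conditioning a triple of signs on its product changes
    neither its means nor its covariances.  Hence (Lindeberg) it perturbs the
    mean of a smoothed indicator of the close election by third differences
    only, and the axes can be replaced by equally many of each kind up to second
    differences: closeness is asymptotically independent of the products.
    Smoothing costs a negligible shell, by the explicit binomial law of the
    reference walk.

    It remains to evaluate the probability that the three sums of products have
    the same sign, i.e. the correlation of the signs of two walks whose steps
    have correlation -1/27.  The Fourier coefficients of the majority satisfy a
    two-term recursion, which gives a power series in 1/27 with explicit
    coefficients, decreasing in the number of groups; its limit is (2/pi) asin(1/27), but only its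
    existence and two rational bounds are needed. *)

Require Import Defs.
From mathcomp Require Import all_boot all_order all_algebra all_fingroup.
From mathcomp Require Import all_classical all_reals all_analysis.
From mathcomp Require Import ring lra zify.
Import Order.TTheory GRing.Theory Num.Theory.
Import numFieldNormedType.Exports.
Set Implicit Arguments.
Unset Strict Implicit.
Unset Printing Implicit Defensive.
Local Open Scope ring_scope.

(** * Averages and shift operators *)

Section Average.
Variable R : realFieldType.

Definition avg (T : finType) (F : T -> R) : R := (\sum_x F x) / #|T|%:R.

Lemma eq_avg (T : finType) (F G : T -> R) : F =1 G -> avg F = avg G.
Proof. by move=> eqFG; congr (_ / _); apply: eq_bigr. Qed.

Lemma avgD (T : finType) (F G : T -> R) : avg (fun x => F x + G x) = avg F + avg G.
Proof. by rewrite /avg big_split mulrDl. Qed.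

Lemma avgZ (T : finType) (a : R) (F : T -> R) : avg (fun x => a * F x) = a * avg F.
Proof. by rewrite /avg -mulr_sumr mulrA. Qed.

Lemma avgB (T : finType) (F G : T -> R) : avg (fun x => F x - G x) = avg F - avg G.
Proof. by rewrite /avg sumrB mulrBl. Qed.

Lemma avg_cst (T : finType) (a : R) : (0 < #|T|)%N -> avg (fun _ : T => a) = a.
Proof.
move=> T_gt0; rewrite /avg sumr_const -[a *+ _]mulr_natr mulfK //.
by rewrite pnatr_eq0 -lt0n.
Qed.

Lemma ler_avg (T : finType) (F G : T -> R) : (forall x, F x <= G x) -> avg F <= avg G.
Proof. by move=> leFG; apply: ler_wpM2r; [rewrite invr_ge0 ler0n | apply: ler_sum]. Qed.

Lemma ler_norm_avg (T : finType) (F : T -> R) : `|avg F| <= avg (fun x => `|F x|).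
Proof.
rewrite /avg normrM normfV normr_nat.
by apply: ler_wpM2r; [rewrite invr_ge0 ler0n | apply: ler_norm_sum].
Qed.

Lemma ler_norm_avg_cst (T : finType) (F : T -> R) (a : R) :
  (0 < #|T|)%N -> (forall x, `|F x| <= a) -> `|avg F| <= a.
Proof.
move=> T_gt0 leFa; apply: le_trans (ler_norm_avg _) _.
by rewrite -[leRHS](avg_cst (T := T)) //; apply: ler_avg.
Qed.

Lemma exchange_avg (T U : finType) (F : T -> U -> R) :
  avg (fun x => avg (F x)) = avg (fun y => avg (F^~ y)).
Proof.
rewrite /avg -!mulr_suml exchange_big /= mulrAC; congr (_ / _).
Qed.

Lemma avg_pair (T U : finType) (F : T * U -> R) :
  avg F = avg (fun x => avg (fun y => F (x, y))).
Proof.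
rewrite /avg -mulr_suml -mulrA -invfM -natrM card_prod [(#|U| * _)%N]mulnC.
by rewrite pair_big; congr (_ / _); apply: eq_bigr => -[].
Qed.

Lemma reindex_avg (T U : finType) (h : T -> U) (F : U -> R) :
  bijective h -> avg (F \o h) = avg F.
Proof.
move=> bij_h; rewrite /avg (bij_eq_card bij_h) [in RHS](reindex h) //.
exact: onW_bij.
Qed.

(** Peeling off the first coordinate of a product space makes averages over independent groups
    accessible to induction on the number of groups. *)
Definition ffun_cons (J : finType) (m : nat) (x : J) (f : {ffun 'I_m -> J}) :=
  [ffun i : 'I_m.+1 => oapp f x (unlift ord0 i)].

Lemma ffun_cons0 (J : finType) m (x : J) (f : {ffun 'I_m -> J}) :
  ffun_cons x f ord0 = x.
Proof. by rewrite ffunE unlift_none. Qed.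

Lemma ffun_consS (J : finType) m (x : J) (f : {ffun 'I_m -> J}) (i : 'I_m) :
  ffun_cons x f (lift ord0 i) = f i.
Proof. by rewrite ffunE liftK. Qed.

Lemma ffun_cons_bij (J : finType) m :
  bijective (fun p : J * {ffun 'I_m -> J} => ffun_cons p.1 p.2).
Proof.
exists (fun f : {ffun 'I_m.+1 -> J} => (f ord0, [ffun i => f (lift ord0 i)])).
  move=> [x f] /=; rewrite ffun_cons0; congr (_, _).
  by apply/ffunP => i; rewrite ffunE ffun_consS.
move=> f; apply/ffunP => i /=; rewrite ffunE.
by case: unliftP => [j ->|->] /=; rewrite ?ffunE.
Qed.

Lemma avg_ffunS (J : finType) m (F : {ffun 'I_m.+1 -> J} -> R) :
  avg F = avg (fun x => avg (fun f => F (ffun_cons x f))).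
Proof. by rewrite -(reindex_avg _ (@ffun_cons_bij J m)) avg_pair. Qed.

Lemma avg_ffun0 (J : finType) (F : {ffun 'I_0 -> J} -> R) (f : {ffun 'I_0 -> J}) :
  avg F = F f.
Proof.
rewrite (@eq_avg _ _ (fun=> F f)) ?avg_cst ?card_ffun ?card_ord //.
by move=> g; congr F; apply/ffunP => -[].
Qed.

Lemma avg_bool (F : bool -> R) : avg F = (F true + F false) / 2.
Proof. by rewrite /avg big_bool card_bool. Qed.

Lemma avg_I3 (F : 'I_3 -> R) :
  avg F = (F (inord 0) + F (inord 1) + F (inord 2)) / 3%:R.
Proof.
rewrite /avg card_ord !big_ord_recl big_ord0 addr0 addrA.
congr ((F _ + F _ + F _) / _); apply: val_inj; by rewrite /= inordK.
Qed.

End Average.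

(** * Convolution with finitely supported signed measures *)

Section ShiftOperators.
Variables (R : realFieldType) (V : zmodType).
Implicit Types (l : seq (R * V)) (psi phi : V -> R) (v z : V).

(** The list [l] is a finite signed measure, given by weights and atoms; [op l] averages [psi] over
    shifts by its atoms. All such operators commute ([opC]), and [lnorm l] is the total mass of the
    weights. *)
Definition op l psi v : R := \sum_(p <- l) p.1 * psi (v + p.2).

Definition lnorm l : R := \sum_(p <- l) `|p.1|.

Lemma opC l l' psi : op l (op l' psi) = op l' (op l psi).
Proof.
apply/funext => v; rewrite /op.
under eq_bigr do rewrite mulr_sumr.
under [RHS]eq_bigr do rewrite mulr_sumr.
rewrite exchange_big; apply: eq_bigr => p _; apply: eq_bigr => q _.
by rewrite mulrCA; congr (_ * (_ * psi _)); rewrite addrAC.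
Qed.

Definition bounded (c : R) psi := forall v, `|psi v| <= c.

Lemma op_bounded l c psi : bounded c psi -> bounded (lnorm l * c) (op l psi).
Proof.
move=> psi_c v; apply: le_trans (ler_norm_sum _ _ _) _.
rewrite mulr_suml; apply: ler_sum => p _.
by rewrite normrM ler_wpM2l.
Qed.

Lemma op_iterC l l' n psi : op l (iter n (op l') psi) = iter n (op l') (op l psi).
Proof. by elim: n => //= n <-; rewrite opC. Qed.

Lemma opB l phi psi v : op l (fun w => phi w - psi w) v = op l phi v - op l psi v.
Proof. by rewrite /op -sumrB; apply: eq_bigr => p _; rewrite mulrBr. Qed.

Lemma op_sum l (I : Type) (r : seq I) (a : I -> R) (F : I -> V -> R) v :
  op l (fun w => \sum_(i <- r) a i * F i w) v = \sum_(i <- r) a i * op l (F i) v.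
Proof.
rewrite /op; under eq_bigr do rewrite mulr_sumr.
rewrite exchange_big; apply: eq_bigr => i _; rewrite mulr_sumr.
by apply: eq_bigr => p _; rewrite mulrCA.
Qed.

Lemma op_cat l l' psi v : op (l ++ l') psi v = op l psi v + op l' psi v.
Proof. by rewrite /op big_cat. Qed.

(** This is the binomial theorem for the commuting operators [op l] and [op l'], whose sum is
    [op (l ++ l')]. *)
Lemma iter_op_cat l l' n psi v :
  iter n (op (l ++ l')) psi v =
  \sum_(s < n.+1) 'C(n, s)%:R * iter (n - s) (op l) (iter s (op l') psi) v.
Proof.
elim: n v => [|n IHn] v; first by rewrite big_ord1 mul1r.
rewrite iterS op_cat.
have -> : iter n (op (l ++ l')) psi = fun w => \sum_(s <- index_enum 'I_n.+1)
  'C(n, s)%:R * iter (n - s) (op l) (iter s (op l') psi) w by apply/funext.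
rewrite !op_sum [RHS]big_ord_recl /= bin0 ?subn0 mul1r.
under [X in _ = _ + X]eq_bigr => s _ do rewrite /bump add1n binS natrD mulrDl subSS.
rewrite big_split /= addrA; congr (_ + _); last first.
  by apply: eq_bigr => s _; rewrite !op_iterC.
rewrite [LHS]big_ord_recl /= bin0 ?subn0 mul1r; congr (_ + _).
rewrite [RHS]big_ord_recr /= bin_small // mul0r addr0.
by apply: eq_bigr => s _; rewrite /bump add1n -iterS -subSn ?subSS ?ltn_ord.
Qed.

End ShiftOperators.

(** * Lindeberg replacement for signed walks *)

Definition sgb (b : bool) : int := if b then 1 else -1.

Definition parity (b : bool * bool * bool) := b.1.1 (+) b.1.2 (+) b.2.

Section SignedWalk.
Variables (R : realFieldType) (V : zmodType) (K : finType) (delta : K -> V).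
Implicit Types (psi phi : V -> R) (v : V) (k : K).

(** For a uniform sign e, [opA k] is the mean of [psi (v + e delta k)], and [opD k] the mean of
    [e psi (v + e delta k)], a centred half difference. *)
Definition opA k : seq (R * V) := [:: (2^-1, delta k); (2^-1, - delta k)].
Definition opD k : seq (R * V) := [:: (2^-1, delta k); (- 2^-1, - delta k)].

Lemma opAE k psi v : op (opA k) psi v = (psi (v + delta k) + psi (v - delta k)) / 2.
Proof. rewrite /op !big_cons big_nil /=; ring. Qed.

Lemma opDE k psi v : op (opD k) psi v = (psi (v + delta k) - psi (v - delta k)) / 2.
Proof. rewrite /op !big_cons big_nil /=; ring. Qed.

Lemma opA_bounded k c psi : bounded c psi -> bounded c (op (opA k) psi).
Proof.
move=> psi_c v; rewrite opAE normrM [`|2^-1|]ger0_norm ?invr_ge0 // ler_pdivrMr //.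
by rewrite mulr_natr mulr2n; apply: le_trans (ler_normD _ _) (lerD _ _).
Qed.

Definition opAs (w : seq K) psi := foldr (fun k => op (opA k)) psi w.

Lemma opAs_bounded w c psi : bounded c psi -> bounded c (opAs w psi).
Proof. by move=> psi_c; elim: w => //= k w; apply: opA_bounded. Qed.

Lemma op_opAs l w psi : op l (opAs w psi) = opAs w (op l psi).
Proof. by elim: w => //= k w <-; rewrite opC. Qed.

Lemma opAs_cat w w' psi : opAs (w ++ w') psi = opAs w (opAs w' psi).
Proof. exact: foldr_cat. Qed.

Lemma opAs_nseq n k psi : opAs (nseq n k) psi = iter n (op (opA k)) psi.
Proof. by elim: n => //= n ->. Qed.

Lemma opAs_perm w w' psi : perm_eq w w' -> opAs w psi = opAs w' psi.
Proof.
elim: w w' => [|k w IHw] w' pww'; first by rewrite perm_sym in pww'; move/perm_nilP: pww' => ->.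
have /path.splitPr p_w' : k \in w' by rewrite -(perm_mem pww') mem_head.
case: p_w' pww' => w1 w2; rewrite perm_sym -cat1s perm_catCA perm_cons perm_sym => pw.
by rewrite opAs_cat /= -op_opAs -opAs_cat (IHw _ pw).
Qed.

Definition group_step (x : K * K * K) (b : bool * bool * bool) : V :=
  delta x.1.1 *~ sgb b.1.1 + delta x.1.2 *~ sgb b.1.2 + delta x.2 *~ sgb b.2.

(* Biasing a triple of signs through its product only adds a third difference. *)
Lemma avg_group_step (g : bool -> R) x phi v :
  avg (fun b => g (parity b) * phi (v + group_step x b)) =
  (g true + g false) / 2 * opAs [:: x.1.1; x.1.2; x.2] phi v +
  (g true - g false) / 2 *
    op (opD x.1.1) (op (opD x.1.2) (op (opD x.2) phi)) v.
Proof.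
rewrite !avg_pair !avg_bool /opAs /group_step /parity /= !(opAE, opDE).
rewrite !(mulr1z, mulrN1z) !addrA; by field.
Qed.

Definition axes m (c : 'I_m -> K * K * K) : seq K :=
  flatten [seq [:: (c i).1.1; (c i).1.2; (c i).2] | i <- enum 'I_m].

Definition walk m (c : 'I_m -> K * K * K) (b : 'I_m -> bool * bool * bool) : V :=
  \sum_i group_step (c i) (b i).

Definition parities m (b : {ffun 'I_m -> bool * bool * bool}) : {ffun 'I_m -> bool} :=
  [ffun i => parity (b i)].

Lemma parities_cons m b0 (b : {ffun 'I_m -> bool * bool * bool}) :
  parities (ffun_cons b0 b) = ffun_cons (parity b0) (parities b).
Proof.
apply/ffunP => i; case: (unliftP ord0 i) => [j ->|->].
  by rewrite ffunE !ffun_consS ffunE.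
by rewrite ffunE !ffun_cons0.
Qed.

Lemma axesS m (c : 'I_m.+1 -> K * K * K) :
  axes c = [:: (c ord0).1.1; (c ord0).1.2; (c ord0).2] ++ axes (c \o lift ord0).
Proof. by rewrite /axes enum_ordSl /= -map_comp. Qed.

Lemma walk_cons m (c : 'I_m.+1 -> K * K * K) b0 (b : {ffun 'I_m -> _}) :
  walk c (ffun_cons b0 b) = group_step (c ord0) b0 + walk (c \o lift ord0) b.
Proof.
rewrite /walk big_ord_recl ffun_cons0; congr (_ + _).
by apply: eq_bigr => i _; rewrite ffun_consS.
Qed.

(** Groups are replaced one at a time. The weight [G] sees a group only through its parity, so by
    [avg_group_step] each replacement costs one third difference, and the averages over the other
    groups do not enlarge it. *)
Lemma lindeberg eta psi m (c : 'I_m -> K * K * K) (G : {ffun 'I_m -> bool} -> R) v :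
  (forall k1 k2 k3, bounded eta (op (opD k1) (op (opD k2) (op (opD k3) psi)))) ->
  (forall e, `|G e| <= 1) ->
  `|avg (fun b => G (parities b) * (psi (v + walk c b) - opAs (axes c) psi v))|
    <= m%:R * eta.
Proof.
move=> psi_eta; elim: m c G v => [|m IHm] c G v G1.
  rewrite (avg_ffun0 _ [ffun=> (true, true, true)]) /walk big_ord0 addr0.
  by rewrite /axes enum_ord0 /= subrr mulr0 normr0 mul0r.
have tgt0 : (0 < #|{: bool * bool * bool}|)%N by rewrite !card_prod card_bool.
have fgt0 : (0 < #|{ffun 'I_m -> bool * bool * bool}|)%N.
  by rewrite card_ffun expn_gt0 tgt0.
rewrite avg_ffunS axesS.
set c' := c \o lift ord0; set phi := opAs (axes c') psi.
pose g e0 := avg (fun b => G (ffun_cons e0 (parities b))).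
have g1 e0 : `|g e0| <= 1 by apply: ler_norm_avg_cst.
(* The first summand replaces the tail groups with the first group fixed and falls to the induction
   hypothesis; the difference of the other two replaces the first group. *)
have -> : avg (fun b0 => avg (fun b => G (parities (ffun_cons b0 b)) *
     (psi (v + walk c (ffun_cons b0 b)) - opAs ([:: (c ord0).1.1; (c ord0).1.2; (c ord0).2] ++ axes c') psi v)))
  = avg (fun b0 => avg (fun b => G (ffun_cons (parity b0) (parities b)) *
      (psi (v + group_step (c ord0) b0 + walk c' b) - phi (v + group_step (c ord0) b0))))
  + avg (fun b0 => g (parity b0) * phi (v + group_step (c ord0) b0))
  - avg (fun b0 => g (parity b0) * opAs [:: (c ord0).1.1; (c ord0).1.2; (c ord0).2] phi v).
  rewrite -avgD -avgB; apply: eq_avg => b0.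
  rewrite ![g _ * _]mulrC -!avgZ -avgD -avgB; apply: eq_avg => b.
  rewrite parities_cons walk_cons addrA opAs_cat -/phi; ring.
rewrite avg_group_step -addrA [m.+1%:R]mulrSr [_ * eta]mulrDl.
apply: le_trans (ler_normD _ _) (lerD _ _).
  by apply: ler_norm_avg_cst => // b0; apply: (IHm c' (fun f => G (ffun_cons (parity b0) f))).
have -> : avg (fun b0 => g (parity b0) * opAs [:: (c ord0).1.1; (c ord0).1.2; (c ord0).2] phi v)
  = (g true + g false) / 2 * opAs [:: (c ord0).1.1; (c ord0).1.2; (c ord0).2] phi v.
  rewrite !avg_pair !avg_bool /parity /=; by field.
rewrite addrAC subrr add0r mul1r normrM -[leRHS]mul1r ler_pM //.
  have := g1 true; have := g1 false; rewrite !ler_norml => /andP[? ?] /andP[? ?].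
  by apply/andP; split; lra.
by rewrite !op_opAs; apply: opAs_bounded.
Qed.

Lemma iter_bounded n k c psi : bounded c psi -> bounded c (iter n (op (opA k)) psi).
Proof. by rewrite -opAs_nseq; apply: opAs_bounded. Qed.

(** Each additional averaging step changes the value by an average of [op (opA k) psi - psi], hence
    by at most [theta]; the changes are telescoped from the smaller count. *)
Lemma dist_iter_opA theta k n n' psi v :
  bounded theta (fun w => op (opA k) psi w - psi w) ->
  `|iter n (op (opA k)) psi v - iter n' (op (opA k)) psi v|
    <= `|n%:R - n'%:R| * theta.
Proof.
move=> psi_th.
have H n1 d : `|iter (n1 + d) (op (opA k)) psi v - iter n1 (op (opA k)) psi v| <= d%:R * theta.
  elim: d => [|d IHd]; first by rewrite addn0 subrr normr0 mul0r.
  rewrite [d.+1%:R]mulrSr [_ * theta]mulrDl mul1r.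
  have -> : iter (n1 + d.+1) (op (opA k)) psi v - iter n1 (op (opA k)) psi v =
    (iter (n1 + d) (op (opA k)) psi v - iter n1 (op (opA k)) psi v) +
    iter (n1 + d) (op (opA k)) (fun w => op (opA k) psi w - psi w) v.
    have -> : iter (n1 + d) (op (opA k)) (fun w => op (opA k) psi w - psi w) v =
      iter (n1 + d).+1 (op (opA k)) psi v - iter (n1 + d) (op (opA k)) psi v.
      rewrite iterSr; elim: (n1 + d)%N {IHd} v => //= j IHj v.
      by rewrite -opB; congr (op _ _ v); apply/funext.
    rewrite addnS; ring.
  apply: le_trans (ler_normD _ _) (lerD IHd _).
  exact: iter_bounded.
case: (leqP n' n) => [le_n'n|/ltnW le_nn'].
  by rewrite -natrB // normr_nat -{1}(subnKC le_n'n); apply: H.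
by rewrite distrC [`|n%:R - _|]distrC -natrB // normr_nat -{1}(subnKC le_nn'); apply: H.
Qed.

End SignedWalk.

Lemma I3_cases (k : 'I_3) : [\/ k = inord 0, k = inord 1 | k = inord 2].
Proof.
case: k => -[|[|[|//]]] ltk; [apply: Or31|apply: Or32|apply: Or33];
  by apply: val_inj; rewrite /= inordK.
Qed.

Lemma inord3_eq i j : (i < 3)%N -> (j < 3)%N -> ((inord i : 'I_3) == inord j) = (i == j).
Proof. by move=> i3 j3; rewrite -val_eqE /= !inordK. Qed.

(** The averaging operators commute, so only the multiplicity of each axis matters. *)
Lemma opAs_axes3 (R : realFieldType) (V : zmodType) (delta : 'I_3 -> V) (psi : V -> R) w :
  opAs delta w psi =
  opAs delta (nseq (count_mem (inord 0) w) (inord 0) ++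
              nseq (count_mem (inord 1) w) (inord 1) ++
              nseq (count_mem (inord 2) w) (inord 2)) psi.
Proof.
apply: opAs_perm; apply/seq.permP => P.
rewrite !count_cat !count_nseq; elim: w => [|k w IHw] /=; first by rewrite !muln0.
rewrite IHw !mulnDr !addnA.
by have [->|->|->] := I3_cases k; rewrite !inord3_eq //=; lia.
Qed.

(** The three multiplicities are moved to [m] one after the other, each time after commuting the
    block concerned to the front. *)
Lemma dist_opAs3 (R : realFieldType) (V : zmodType) (delta : 'I_3 -> V) (psi : V -> R)
    theta w m v :
  (forall k, bounded theta (fun u => op (opA R delta k) psi u - psi u)) ->
  `|opAs delta w psi v -
    opAs delta (nseq m (inord 0) ++ nseq m (inord 1) ++ nseq m (inord 2)) psi v|
    <= (`|(count_mem (inord 0) w)%:R - m%:R| + `|(count_mem (inord 1) w)%:R - m%:R|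
        + `|(count_mem (inord 2) w)%:R - m%:R|) * theta.
Proof.
move=> psi_th.
have th' w' k : bounded theta (fun u => op (opA R delta k) (opAs delta w' psi) u - opAs delta w' psi u).
  have -> : (fun u => op (opA R delta k) (opAs delta w' psi) u - opAs delta w' psi u) =
     opAs delta w' (fun u => op (opA R delta k) psi u - psi u).
    rewrite op_opAs; apply/funext; elim: w' => //= k' w' IHw u.
    by rewrite -opB; congr (op _ _ u); apply/funext.
  exact: opAs_bounded.
rewrite opAs_axes3.
set n0 := count_mem _ w; set n1 := count_mem _ w; set n2 := count_mem _ w.
set F := fun a b c => opAs delta (nseq a (inord 0) ++ nseq b (inord 1) ++ nseq c (inord 2)) psi v.
rewrite -/(F n0 n1 n2) -/(F m m m) !mulrDl.
have -> : F n0 n1 n2 - F m m m = (F n0 n1 n2 - F m n1 n2) + (F m n1 n2 - F m m n2) + (F m m n2 - F m m m) by ring.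
apply: le_trans (ler_normD _ _) (lerD (le_trans (ler_normD _ _) (lerD _ _)) _).
- by rewrite /F ![opAs _ (nseq _ (inord 0) ++ _) _]opAs_cat !opAs_nseq; apply: dist_iter_opA.
- have E b : F m b n2 = opAs delta (nseq b (inord 1) ++ nseq m (inord 0) ++ nseq n2 (inord 2)) psi v.
    by rewrite /F (opAs_perm _ _ (permEl (perm_catCA _ _ _))).
  by rewrite !E ![opAs _ (nseq _ (inord 1) ++ _) _]opAs_cat !opAs_nseq; apply: dist_iter_opA.
- have E b : F m m b = opAs delta (nseq b (inord 2) ++ nseq m (inord 0) ++ nseq m (inord 1)) psi v.
    by rewrite /F catA; congr (_ v); apply: opAs_perm; apply: permEl; apply: perm_catC.
  by rewrite !E ![opAs _ (nseq _ (inord 2) ++ _) _]opAs_cat !opAs_nseq; apply: dist_iter_opA.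
Qed.

(** * Smoothing and decoupling *)

Section Smoothing.
Variables (R : realFieldType) (V : zmodType) (delta : 'I_3 -> V) (L : nat).
Hypothesis L_gt0 : (0 < L)%N.
Implicit Types (psi phi : V -> R) (v : V) (k : 'I_3).

Definition opU k : seq (R * V) := [seq (L%:R^-1, delta k *+ i) | i <- iota 0 L].

Definition opdiff k : seq (R * V) := [:: (1, delta k); (-1, 0)].

Lemma opUE k psi v : op (opU k) psi v = L%:R^-1 * \sum_(0 <= i < L) psi (v + delta k *+ i).
Proof. by rewrite /op big_map /= -mulr_sumr /index_iota subn0. Qed.

Lemma L_neq0 : L%:R != 0 :> R. Proof. by rewrite pnatr_eq0 -lt0n. Qed.

Lemma opU_bounded k c psi : bounded c psi -> bounded c (op (opU k) psi).
Proof.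
move=> psi_c; suff <- : lnorm (opU k) * c = c by apply: op_bounded.
rewrite /lnorm big_map /= big_const_seq count_predT size_iota iter_addr addr0.
by rewrite ger0_norm ?invr_ge0 ?ler0n // -[_^-1 *+ L]mulr_natr mulVf ?mul1r // L_neq0.
Qed.

Lemma opdiffE k psi v : op (opdiff k) psi v = psi (v + delta k) - psi v.
Proof. rewrite /op !big_cons big_nil /= !addr0; ring. Qed.

(** The difference of a running mean telescopes to its two boundary terms. *)
Lemma opdiff_opU k c psi : bounded c psi ->
  bounded (2 / L%:R * c) (op (opdiff k) (op (opU k) psi)).
Proof.
move=> psi_c v; rewrite opdiffE !opUE -mulrBr -sumrB.
under eq_bigr => i _ do rewrite -addrA -mulrS.
rewrite telescope_sumr // mulr0n addr0 normrM ger0_norm ?invr_ge0 ?ler0n //.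
rewrite [2 / _]mulrC -mulrA ler_wpM2l ?invr_ge0 ?ler0n //.
by rewrite mulr_natl mulr2n; apply: le_trans (ler_normB _ _) (lerD _ _).
Qed.

Definition smooth1 psi :=
  op (opU (inord 0)) (op (opU (inord 1)) (op (opU (inord 2)) psi)).

Lemma smooth1_bounded c psi : bounded c psi -> bounded c (smooth1 psi).
Proof. by move=> psi_c; do 3! apply: opU_bounded. Qed.

Lemma op_smooth1 l psi : op l (smooth1 psi) = smooth1 (op l psi).
Proof. by rewrite /smooth1 3!(opC l). Qed.

Lemma opdiff_smooth1 k c psi : bounded c psi ->
  bounded (2 / L%:R * c) (op (opdiff k) (smooth1 psi)).
Proof.
move=> psi_c; rewrite /smooth1; have [->|->|->] := I3_cases k.
- by apply: opdiff_opU; do 2! apply: opU_bounded.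
- by rewrite opC; apply: opU_bounded; apply: opdiff_opU; apply: opU_bounded.
- by rewrite !(opC (opdiff _)); do 2! apply: opU_bounded; rewrite -!(opC (opdiff _)); apply: opdiff_opU.
Qed.

(** A centred half difference is the mean of two consecutive forward differences. *)
Lemma opD_smooth1 k c psi : bounded c psi ->
  bounded (2 / L%:R * c) (op (opD R delta k) (smooth1 psi)).
Proof.
move=> /(@opdiff_smooth1 k) psi_c v.
have -> : op (opD R delta k) (smooth1 psi) v =
    (op (opdiff k) (smooth1 psi) v + op (opdiff k) (smooth1 psi) (v - delta k)) / 2.
  by rewrite opDE !opdiffE subrK; congr (_ / _); ring.
rewrite normrM [`|2^-1|]ger0_norm ?invr_ge0 // ler_pdivrMr //.
by rewrite mulr_natr mulr2n; apply: le_trans (ler_normD _ _) (lerD _ _).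
Qed.

(** Each round averages along all three axes, so it gains a factor [2 / L] for a difference along
    any axis. Three rounds serve the third differences of [lindeberg]. *)
Definition smooth psi := smooth1 (smooth1 (smooth1 psi)).

Lemma opD3_smooth k1 k2 k3 psi : bounded 1 psi ->
  bounded (8 / L%:R ^+ 3)
    (op (opD R delta k1) (op (opD R delta k2) (op (opD R delta k3) (smooth psi)))).
Proof.
move=> psi1; have -> : 8 / L%:R ^+ 3 = 2 / L%:R * (2 / L%:R * (2 / L%:R * 1)) :> R.
  by field; apply: L_neq0.
rewrite /smooth (op_smooth1 (opD _ _ k3)) (op_smooth1 (opD _ _ k2)); apply: opD_smooth1.
rewrite (op_smooth1 (opD _ _ k3)); apply: opD_smooth1.
exact: opD_smooth1.
Qed.

(** Averaging minus the identity is half a second difference, so two of the three rounds are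
    consumed. *)
Lemma opA_smooth k psi : bounded 1 psi ->
  bounded (2 / L%:R ^+ 2) (fun v => op (opA R delta k) (smooth psi) v - smooth psi v).
Proof.
move=> psi1 v.
have -> : op (opA R delta k) (smooth psi) v - smooth psi v =
    op (opdiff k) (op (opdiff k) (smooth psi)) (v - delta k) / 2.
  by rewrite opAE !opdiffE subrK; field.
rewrite normrM [`|2^-1|]ger0_norm ?invr_ge0 // ler_pdivrMr //.
have -> : 2 / L%:R ^+ 2 * 2 = 2 / L%:R * (2 / L%:R * 1) :> R by field; apply: L_neq0.
rewrite /smooth (op_smooth1 (opdiff k)).
apply: opdiff_smooth1; apply: opdiff_smooth1; exact: smooth1_bounded.
Qed.

End Smoothing.

(* The contribution to the three vote margins of a voter whose odd-one-out
   comparison is k, up to sign. *)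
Definition axis (k : 'I_3) : {ffun 'I_3 -> int} :=
  [ffun l => if l == k then 1 else -1].

Definition box (t : nat) (v : {ffun 'I_3 -> int}) : bool :=
  [forall k, (absz (v k) <= t)%N].

Lemma absz_shift (x y : int) (t L : nat) : (absz y < L)%N ->
  (absz (x + y)%R <= t)%N -> (absz x <= t + L)%N.
Proof. by lia. Qed.

Lemma absz_unshift (x y : int) (t L : nat) : (absz y < L)%N ->
  (absz x <= t)%N -> (absz (x + y)%R <= t + L)%N.
Proof. by lia. Qed.

(** * Smoothed indicators between indicators of nearby boxes *)

Section Sandwich.
Variables (R : realFieldType) (L : nat).
Hypothesis L_gt0 : (0 < L)%N.
Notation opU := (opU R axis L).

Lemma box_shift t (v : {ffun 'I_3 -> int}) k i : (i < L)%N -> box t (v + axis k *+ i) -> box (t + L) v.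
Proof.
move=> ltiL /forallP bt; apply/forallP => l; have := bt l.
by rewrite !ffunE ffunMnE ffunE; case: (l == k); rewrite ?mulNrn natz; apply: absz_shift; rewrite ?abszN.
Qed.

Lemma box_unshift t (v : {ffun 'I_3 -> int}) k i : (i < L)%N -> box t v -> box (t + L) (v + axis k *+ i).
Proof.
move=> ltiL /forallP bt; apply/forallP => l; have := bt l.
by rewrite !ffunE ffunMnE ffunE; case: (l == k); rewrite ?mulNrn natz; apply: absz_unshift; rewrite ?abszN.
Qed.

Lemma opU_le_box t k (phi : _ -> R) :
  (forall v, phi v <= (box t v)%:R) -> forall v, op (opU k) phi v <= (box (t + L) v)%:R.
Proof.
move=> le_phi v; rewrite opUE ler_pdivrMl ?ltr0n // mulr_natl.
rewrite -[X in _ *+ X]subn0 -sumr_const_nat ler_sum_nat // => i /andP[_ ltiL].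
apply: le_trans (le_phi _) _; rewrite ler_nat.
by case: (boolP (box t _)) => // /(box_shift ltiL) ->.
Qed.

Lemma opU_ge_box t k (phi : _ -> R) :
  (forall v, (box (t + L) v)%:R <= phi v) -> forall v, (box t v)%:R <= op (opU k) phi v.
Proof.
move=> le_phi v; rewrite opUE ler_pdivlMl ?ltr0n // mulr_natl.
rewrite -[X in _ *+ X]subn0 -sumr_const_nat ler_sum_nat // => i /andP[_ ltiL].
apply: le_trans (le_phi _); rewrite ler_nat.
by case: (boolP (box t _)) => // /(box_unshift k ltiL) ->.
Qed.

(** There are nine running means, three axes in each of three rounds, and each moves every
    coordinate by less than [L]; this explains the margin [9 * L]. *)
Lemma smooth_le_box t v :
  smooth axis L (fun u => (box t u)%:R : R) v <= (box (t + 9 * L) v)%:R.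
Proof.
have -> : (t + 9 * L = t + L + L + L + L + L + L + L + L + L)%N by lia.
by do 9! (apply: opU_le_box => {}v).
Qed.

Lemma smooth_ge_box t v :
  (box t v)%:R <= smooth axis L (fun u => (box (t + 9 * L) u)%:R : R) v.
Proof.
have -> : (t + 9 * L = t + L + L + L + L + L + L + L + L + L)%N by lia.
by do 9! (apply: opU_ge_box => {}v).
Qed.

End Sandwich.

(** Variance is additive over independent coordinates; the mean is carried along because the cross
    term in the induction contains it. *)
Lemma avg_sum_sqr (R : realFieldType) (J : finType) (h : J -> R) m :
  (0 < #|J|)%N -> avg h = 0 ->
  avg (fun c : {ffun 'I_m -> J} => (\sum_i h (c i)) ^+ 2) = m%:R * avg (fun x => h x ^+ 2)
  /\ avg (fun c : {ffun 'I_m -> J} => \sum_i h (c i)) = 0.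
Proof.
move=> J_gt0 h0; have /card_gt0P[x0 _] := J_gt0.
have F_gt0 n : (0 < #|{ffun 'I_n -> J}|)%N by rewrite card_ffun expn_gt0 J_gt0.
elim: m => [|m [IH2 IH1]].
  by rewrite !(avg_ffun0 _ [ffun=> x0]) big_ord0 expr0n mul0r.
have E x (c : {ffun 'I_m -> J}) : \sum_i h (ffun_cons x c i) = h x + \sum_i h (c i).
  by rewrite big_ord_recl ffun_cons0; congr (_ + _); apply: eq_bigr => i _; rewrite ffun_consS.
rewrite !avg_ffunS; split; last first.
  rewrite -[RHS]h0; apply: eq_avg => x.
  by under eq_avg do rewrite E; rewrite avgD avg_cst // IH1 addr0.
have -> : avg (fun x => avg (fun c : {ffun 'I_m -> J} => (\sum_i h (ffun_cons x c i)) ^+ 2))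
  = avg (fun x => h x ^+ 2 + m%:R * avg (fun x => h x ^+ 2)).
  apply: eq_avg => x.
  rewrite (eq_avg (G := fun c : {ffun 'I_m -> J} =>
     h x ^+ 2 + (2 * h x * (\sum_i h (c i)) + (\sum_i h (c i)) ^+ 2))); last first.
    by move=> c; rewrite E; ring.
  by rewrite avgD avg_cst // avgD avgZ IH1 mulr0 add0r IH2.
by rewrite avgD avg_cst // [m.+1%:R]mulrS mulrDl mul1r.
Qed.

(** * Asymptotic independence of the walk and the group parities *)

Section Decoupling.
Variables (R : realFieldType) (m L : nat) (s : R).
Hypotheses (L_gt0 : (0 < L)%N) (s_gt0 : 0 < s) (s2 : s ^+ 2 = m%:R).

Let X := ('I_3 * 'I_3 * 'I_3)%type.

Lemma cardX_gt0 : (0 < #|{: X}|)%N.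
Proof. by rewrite !card_prod card_ord. Qed.

Lemma cardXs_gt0 : (0 < #|{ffun 'I_m -> X}|)%N.
Proof. by rewrite card_ffun expn_gt0 cardX_gt0. Qed.

Lemma cardBs_gt0 : (0 < #|{ffun 'I_m -> bool * bool * bool}|)%N.
Proof. by rewrite card_ffun expn_gt0 !card_prod card_bool. Qed.

Lemma avg_axis_count k :
  avg (fun c : {ffun 'I_m -> X} => `|(count_mem k (axes c))%:R - m%:R| : R) <= s.
Proof.
pose h (x : X) : R := (x.1.1 == k)%:R + (x.1.2 == k)%:R + (x.2 == k)%:R - 1.
have E (c : {ffun 'I_m -> X}) : (count_mem k (axes c))%:R - m%:R = \sum_i h (c i).
  rewrite sumrB sumr_const card_ord; congr (_ - _).
  rewrite /axes count_flatten -map_comp sumnE big_map big_enum /= natr_sum.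
  by apply: eq_bigr => i _; rewrite addn0 !natrD addrA.
have h0 : avg h = 0.
  by rewrite !avg_pair !avg_I3 /h /=; have [->|->|->] := I3_cases k; rewrite !inord3_eq //=; field.
(* This is the variance of the number of occurrences of [k] in a group, binomial with parameters 3
   and 1/3. *)
have h2 : avg (fun x => h x ^+ 2) = 2 / 3%:R.
  by rewrite !avg_pair !avg_I3 /h /=; have [->|->|->] := I3_cases k; rewrite !inord3_eq //=; field.
have [V _] := avg_sum_sqr m cardX_gt0 h0.
(* The inequality [2 s |x| <= s^2 + x^2] bounds the first absolute moment by the second and replaces
   Cauchy-Schwarz; the outcome is [s / 2 + s / 3]. *)
apply: le_trans (_ : avg (fun c : {ffun 'I_m -> X} => s / 2 + (2 * s)^-1 * (\sum_i h (c i)) ^+ 2) <= s).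
  apply: ler_avg => c; rewrite E; set x := \sum_i _.
  have -> : s / 2 + (2 * s)^-1 * x ^+ 2 = (s ^+ 2 + `|x| ^+ 2) / (2 * s).
    by rewrite real_normK ?num_real //; field; rewrite gt_eqF.
  rewrite ler_pdivlMr ?mulr_gt0 //.
  rewrite -subr_ge0.
  have -> : s ^+ 2 + `|x| ^+ 2 - `|x| * (2 * s) = (s - `|x|) ^+ 2 by ring.
  exact: sqr_ge0.
rewrite avgD avg_cst ?cardXs_gt0 // avgZ V h2 -s2.
have -> : s / 2 + (2 * s)^-1 * (s ^+ 2 * (2 / 3%:R)) = s * (5 / 6) by field; rewrite gt_eqF.
by rewrite ler_piMr ?ltW //; lra.
Qed.

(** The first term is the cost of [lindeberg] over [m] groups; the second is the cost of equalising
    three axis counts, each with mean deviation at most [s]. *)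
Definition decoupling_error : R := m%:R * (8 / L%:R ^+ 3) + 3 * s * (2 / L%:R ^+ 2).

(** This is the mean of [psi] at the end of the reference walk, which takes exactly [m] signed steps
    along each axis. *)
Definition mean_walk (psi : {ffun 'I_3 -> int} -> R) : R :=
  opAs axis (nseq m (inord 0) ++ nseq m (inord 1) ++ nseq m (inord 2)) psi 0.

(** For fixed axes, [lindeberg] replaces the walk by [opAs axis (axes c)]; then [dist_opAs3]
    replaces the random axis counts by [m], at a cost averaged with [avg_axis_count]. *)
Lemma decoupling (psi : _ -> R) (G : {ffun 'I_m -> X} -> {ffun 'I_m -> bool} -> R) :
  bounded 1 psi -> (forall c e, `|G c e| <= 1) ->
  `|avg (fun c => avg (fun b => G c (parities b) * smooth axis L psi (walk axis c b)))
    - avg (fun c => avg (fun b => G c (parities b))) * mean_walk (smooth axis L psi)|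
  <= decoupling_error.
Proof.
move=> psi1 G1; set phi := smooth axis L psi.
have -> : avg (fun c => avg (fun b => G c (parities b) * phi (walk axis c b)))
    - avg (fun c => avg (fun b => G c (parities b))) * mean_walk phi =
  avg (fun c : {ffun 'I_m -> X} =>
    avg (fun b => G c (parities b) * (phi (0 + walk axis c b) - opAs axis (axes c) phi 0))
    + (opAs axis (axes c) phi 0 - mean_walk phi) * avg (fun b => G c (parities b))).
  rewrite [_ * mean_walk _]mulrC -avgZ -avgB; apply: eq_avg => c.
  rewrite -!avgZ -avgB -avgD; apply: eq_avg => b; rewrite add0r; ring.
apply: le_trans (ler_norm_avg _) _.
pose dev (c : {ffun 'I_m -> X}) : R := `|(count_mem (inord 0) (axes c))%:R - m%:R| +
  `|(count_mem (inord 1) (axes c))%:R - m%:R| + `|(count_mem (inord 2) (axes c))%:R - m%:R|.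
apply: le_trans (_ : avg (fun c => m%:R * (8 / L%:R ^+ 3) + 2 / L%:R ^+ 2 * dev c) <= _).
  apply: ler_avg => c; apply: le_trans (ler_normD _ _) (lerD _ _).
    by apply: lindeberg => // k1 k2 k3; apply: opD3_smooth.
  rewrite normrM mulrC -[leRHS]mul1r ler_pM //.
    by apply: ler_norm_avg_cst cardBs_gt0 _.
  by rewrite mulrC; apply: dist_opAs3 => k; apply: opA_smooth.
rewrite avgD avg_cst ?cardXs_gt0 // avgZ lerD2l mulrC ler_wpM2r ?divr_ge0 ?exprn_ge0 ?ler0n //.
have -> : 3 * s = s + s + s by ring.
by rewrite /dev !avgD !lerD // avg_axis_count.
Qed.

End Decoupling.

(** * Correlation of the signs of two walks *)

Lemma iter_op1 (R : realFieldType) (V : zmodType) (a : R) (z : V) n (psi : V -> R) v :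
  iter n (op [:: (a, z)]) psi v = a ^+ n * psi (v + z *+ n).
Proof.
elim: n v => [|n IHn] v /=; first by rewrite mul1r addr0.
by rewrite {1}/op big_seq1 /= IHn mulrA -exprS -addrA -mulrS.
Qed.

(** The index [i] counts the negative steps of the sign walk. *)
Lemma iter_opA (R : realFieldType) (V : zmodType) (K : finType) (delta : K -> V) k n
    (psi : V -> R) v :
  iter n (op (opA R delta k)) psi v =
  \sum_(i < n.+1) 'C(n, i)%:R / 2 ^+ n * psi (v + delta k *~ (n%:Z - (i + i)%:Z)).
Proof.
rewrite -[opA R delta k]/([:: (2^-1, delta k)] ++ [:: (2^-1, - delta k)]) iter_op_cat.
apply: eq_bigr => i _; have le_in : (i <= n)%N by rewrite -ltnS.
rewrite -mulrA; congr (_ * _).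
rewrite iter_op1 iter_op1 mulrA -exprD subnK // exprVn; congr (_ * psi _).
rewrite -addrA; congr (_ + _); rewrite mulNrn [delta k *+ _]pmulrn [delta k *+ i]pmulrn -mulrzBr.
by congr (_ *~ _); lia.
Qed.

(** * Fourier expansion of the correlation of two majorities *)

Section BivariateSign.
Variable R : realFieldType.

Definition unit_step (_ : unit) : int := 1.
Notation A := (op (opA R unit_step tt)).
Notation B := (op (opD R unit_step tt)).

Lemma opA_unitE (psi : int -> R) v : A psi v = (psi (v + 1) + psi (v - 1)) / 2.
Proof. exact: opAE. Qed.

Lemma opD_unitE (psi : int -> R) v : B psi v = (psi (v + 1) - psi (v - 1)) / 2.
Proof. exact: opDE. Qed.

(** [stepAA] is the law of two independent signs; adding [stepBB q] changes the weights to
    [(1 + q) / 4] on equal and [(1 - q) / 4] on opposite signs, that is, to correlation [q]. *)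
Definition stepAA : seq (R * (int * int)) :=
  [:: (4^-1, (1, 1)); (4^-1, (1, -1)); (4^-1, (-1, 1)); (4^-1, (-1, -1))].
Definition stepBB (q : R) : seq (R * (int * int)) :=
  [:: (q / 4, (1, 1)); (- q / 4, (1, -1)); (- q / 4, (-1, 1)); (q / 4, (-1, -1))].

Lemma iter_stepAA n (f g : int -> R) a :
  iter n (op stepAA) (fun p => a * (f p.1 * g p.2)) =
  fun p => a * (iter n A f p.1 * iter n A g p.2).
Proof.
elim: n => //= n ->; apply/funext => -[v w].
rewrite /op /stepAA !big_cons !big_nil /=; by field.
Qed.

Lemma iter_stepBB q n (f g : int -> R) :
  iter n (op (stepBB q)) (fun p => f p.1 * g p.2) =
  fun p => q ^+ n * (iter n B f p.1 * iter n B g p.2).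
Proof.
elim: n => [|n IHn]; first by apply/funext => -[v w]; rewrite expr0 mul1r.
rewrite iterS IHn; apply/funext => -[v w].
rewrite !iterS /op /stepBB !big_cons !big_nil /= exprS; by field.
Qed.

(** On product functions the step is A tensor A plus [q] times B tensor B; the binomial theorem then
    groups the correlation by Fourier level [s]. *)
Lemma iter_correlated q n (f g : int -> R) :
  iter n (op (stepAA ++ stepBB q)) (fun p => f p.1 * g p.2) (0, 0) =
  \sum_(s < n.+1) 'C(n, s)%:R * q ^+ s *
    (iter (n - s) A (iter s B f) 0 * iter (n - s) A (iter s B g) 0).
Proof.
rewrite iter_op_cat; apply: eq_bigr => s _.
by rewrite iter_stepBB iter_stepAA mulrA.
Qed.

(** Multiplication by [v] has commutator B with A, and commutator A with B ([opD_mul]). *)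
Lemma opA_mul (f : int -> R) : A (fun v => v%:~R * f v) = fun v => v%:~R * A f v + B f v.
Proof.
by apply/funext => v; rewrite !opA_unitE opD_unitE intrD intrB; field.
Qed.

Lemma opD_mul (f : int -> R) : B (fun v => v%:~R * f v) = fun v => v%:~R * B f v + A f v.
Proof.
by apply/funext => v; rewrite !opD_unitE opA_unitE intrD intrB; field.
Qed.

Lemma opBD l (f g : int -> R) v : op l (fun w => f w + g w) v = op l f v + op l g v.
Proof. by rewrite /op -big_split; apply: eq_bigr => p _; rewrite mulrDr. Qed.

Lemma opZ l (a : R) (f : int -> R) v : op l (fun w => a * f w) v = a * op l f v.
Proof. by rewrite /op mulr_sumr; apply: eq_bigr => p _; rewrite mulrCA. Qed.

Lemma iterA_mul n (f : int -> R) v :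
  iter n A (fun w => w%:~R * f w) v = v%:~R * iter n A f v + n%:R * B (iter n.-1 A f) v.
Proof.
elim: n v => [|n IHn] v; first by rewrite mul0r addr0.
rewrite !iterS (_ : iter n A _ = (fun w => w%:~R * iter n A f w + n%:R * B (iter n.-1 A f) w)); last exact/funext.
rewrite opBD opA_mul opZ -addrA; congr (_ + _).
by case: n {IHn} => [|n]; rewrite /= ?mul0r ?addr0 ?mul1r // opC [n.+2%:R]mulrS mulrDl mul1r.
Qed.

Lemma iterD_mul n (f : int -> R) v :
  iter n B (fun w => w%:~R * f w) v = v%:~R * iter n B f v + n%:R * A (iter n.-1 B f) v.
Proof.
elim: n v => [|n IHn] v; first by rewrite mul0r addr0.
rewrite !iterS (_ : iter n B _ = (fun w => w%:~R * iter n B f w + n%:R * A (iter n.-1 B f) w)); last exact/funext.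
rewrite opBD opD_mul opZ -addrA; congr (_ + _).
by case: n {IHn} => [|n]; rewrite /= ?mul0r ?addr0 ?mul1r // opC [n.+2%:R]mulrS mulrDl mul1r.
Qed.

Definition origin (v : int) : R := (v == 0)%:R.

(* Fourier coefficient, on a set of b coordinates of the (a+b)-cube, of the
   indicator that the sum of all coordinates vanishes. *)
Definition zcoef a b : R := iter a A (iter b B origin) 0.

(** The function [v * origin v] vanishes identically. Commuting the factor [v] out of the [a]
    operators A and the [b] operators B, and evaluating at 0, leaves this relation. *)
Lemma zcoef_rec a b :
  a%:R * zcoef a.-1 b.+1 + b%:R * zcoef a.+1 b.-1 = 0.
Proof.
have M0 : (fun w => w%:~R * origin w) = fun=> 0.
  by apply/funext => w; rewrite /origin; case: eqP => [->|]; rewrite ?mul0r ?mulr0.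
have I0 n l : iter n (op l) (fun _ : int => 0 : R) = fun=> 0.
  elim: n => //= n ->; apply/funext => v; rewrite /op big1 // => p _; exact: mulr0.
have : iter a A (iter b B (fun w => w%:~R * origin w)) 0 = 0 by rewrite M0 !I0.
rewrite (_ : iter b B _ = (fun w => w%:~R * iter b B origin w + b%:R * A (iter b.-1 B origin) w)); last first.
  by apply/funext => w; apply: iterD_mul.
have -> (f g : int -> R) : iter a A (fun w => f w + b%:R * g w) 0 = iter a A f 0 + b%:R * iter a A g 0.
  elim: a (0 : int) => //= n IHn v.
  rewrite (_ : iter n A _ = (fun w => iter n A f w + b%:R * iter n A g w)); last exact/funext.
  by rewrite opBD opZ.
by rewrite iterA_mul mul0r add0r /zcoef -iterSr /= op_iterC.
Qed.

Lemma zcoef1 a : zcoef a 1 = 0.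
Proof.
have := zcoef_rec a.+1 0; rewrite mul0r addr0 /= => /eqP.
by rewrite mulf_eq0 pnatr_eq0 => /eqP.
Qed.

Lemma zcoefSS a b : zcoef a b.+2 = - (b.+1%:R / a.+1%:R) * zcoef a.+2 b.
Proof.
have := zcoef_rec a.+1 b.+1; rewrite /= => /eqP; rewrite addr_eq0 => /eqP E.
have a1 : a.+1%:R != 0 :> R by rewrite pnatr_eq0.
by apply: (mulfI a1); rewrite E; field; rewrite addrC natr1.
Qed.

Lemma zcoef_odd a b : zcoef a b.*2.+1 = 0.
Proof. by elim: b a => [|b IHb] a; rewrite ?zcoef1 // doubleS zcoefSS IHb mulr0. Qed.

(** This is the probability that simple random walk is at the origin after [2 j] steps. *)
Definition cbin j : R := 'C(j.*2, j)%:R / 4 ^+ j.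

Lemma cbin0 : cbin 0 = 1. Proof. by rewrite /cbin divr1. Qed.

Lemma cbinS j : cbin j.+1 = cbin j * (j.*2.+1%:R / j.*2.+2%:R).
Proof.
have E : ('C(j.+1.*2, j.+1) * j.+1 = 'C(j.*2, j) * j.*2.+1 * 2)%N.
  have H1 := mul_bin_diag j.*2.+2 j; have H2 := mul_bin_left j.*2.+1 j.
  have H3 := mul_bin_down j.*2.+1 j; rewrite /= in H1 H3.
  rewrite doubleS; nia.
have /(congr1 (fun n : nat => n%:R : R)) : ('C(j.+1.*2, j.+1) * j.+1 = 'C(j.*2, j) * j.*2.+1 * 2)%N := E.
rewrite !natrM /cbin exprS => E'.
have -> : j.*2.+2%:R = 2 * j.+1%:R :> R by rewrite -doubleS -mul2n natrM.
have j1 : j.+1%:R != 0 :> R by rewrite pnatr_eq0.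
apply: (mulIf j1); rewrite mulrAC E'.
have f4 : 4 ^+ j != 0 :> R by rewrite expf_neq0 ?pnatr_eq0.
rewrite mulrA [RHS]mulrAC. field.
by rewrite addrC natr1 j1 f4.
Qed.

Lemma zcoef0 j : zcoef j.*2 0 = cbin j.
Proof.
rewrite /zcoef iter_opA (bigD1 (inord j)) //= big1 ?addr0.
  rewrite inordK ?ltnS -?addnn ?leq_addr // subrr mulr0z addr0 /origin eqxx mulr1.
  by rewrite /cbin addnn -{2}mul2n exprM -[2 ^+ 2]natrX.
move=> i; rewrite -val_eqE /= inordK ?ltnS -?addnn ?leq_addr // => ij.
by rewrite /origin add0r /unit_step intz; case: eqP => [E|_]; rewrite ?mulr0 //; lia.
Qed.

Lemma cbin_gt0 j : 0 < cbin j.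
Proof. by rewrite divr_gt0 ?exprn_gt0 ?ltr0n // bin_gt0 -addnn leq_addr. Qed.

(** Induction on [r]: [zcoefSS] trades two operators B for two operators A, and the resulting
    factors match those of [cbinS] and of the binomial coefficient. *)
Lemma zcoef_sqr j r :
  'C((j + r).*2, r.*2)%:R * zcoef j.*2 r.*2 ^+ 2 = cbin (j + r) * cbin j * cbin r.
Proof.
elim: r j => [|r IHr] j; first by rewrite addn0 bin0 zcoef0 cbin0; ring.
have := IHr j.+1; rewrite addSnnS doubleS => IH.
rewrite [r.+1.*2]doubleS zcoefSS.
have E : ('C((j + r.+1).*2, r.*2.+2) * (r.*2.+2 * r.*2.+1) =
          'C((j + r.+1).*2, r.*2) * (j.*2.+2 * j.*2.+1))%N.
  have H1 := mul_bin_left (j + r.+1).*2 r.*2.+1; have H2 := mul_bin_left (j + r.+1).*2 r.*2.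
  rewrite (_ : (j + r.+1).*2 - r.*2.+1 = j.*2.+1)%N in H1; last lia.
  rewrite (_ : (j + r.+1).*2 - r.*2 = j.*2.+2)%N in H2; last lia.
  nia.
move/(congr1 (fun n : nat => n%:R : R)): E; rewrite !natrM => E.
have r1 : r.*2.+2%:R * r.*2.+1%:R != 0 :> R by rewrite -natrM pnatr_eq0.
have j1 : j.*2.+1%:R != 0 :> R by rewrite pnatr_eq0.
have j2 : j.*2.+2%:R != 0 :> R by rewrite pnatr_eq0.
have {}IH : 'C((j + r.+1).*2, r.*2)%:R * zcoef j.*2.+2 r.*2 ^+ 2 =
  cbin (j + r.+1) * (cbin j * (j.*2.+1%:R / j.*2.+2%:R)) * cbin r by rewrite -cbinS.
rewrite cbinS.
move: E IH r1 j1 j2; set C2 := 'C(_, r.*2.+2)%:R; set C0 := 'C(_, r.*2)%:R.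
set a := r.*2.+1%:R; set a' := r.*2.+2%:R; set b := j.*2.+1%:R; set b' := j.*2.+2%:R.
clearbody C2 C0 a a' b b'.
move: (zcoef _ _) => z E IH; rewrite mulf_eq0 negb_or => /andP[a'0 a0] b0 b'0.
have -> : C2 = C0 * (b' * b) / (a' * a) by rewrite -E mulfK // mulf_neq0.
transitivity (C0 * z ^+ 2 * (a * b' / (b * a'))); first by field; rewrite a0 a'0 b0.
by rewrite IH; field; rewrite b0 a'0 b'0.
Qed.

(** A sum of an odd number of signs is odd, so the even values are free; setting them to 0 makes the
    half difference of the sign exactly [origin]. *)
Definition parity_sign (v : int) : R := if odd (absz v) then (Num.sg v)%:~R else 0.

Lemma opD_parity_sign : B parity_sign = origin.
Proof.
apply/funext => v; rewrite opD_unitE /parity_sign /origin.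
case: (ltrgt0P v) => [v_gt0|v_lt0|->]; last first.
  by rewrite add0r sub0r abszN sgrN sgr1 rmorphN /=; field.
  have [->|v_neq1] := eqVneq v (-1); first by rewrite /= subrr mul0r.
  have -> : odd (absz (v + 1)) = odd (absz (v - 1)) by lia.
  rewrite !ltr0_sg; [|lia|lia]; by rewrite subrr mul0r.
have [->|v_neq1] := eqVneq v 1; first by rewrite /= subrr mul0r.
have -> : odd (absz (v + 1)) = odd (absz (v - 1)) by lia.
rewrite !gtr0_sg; [|lia|lia]; by rewrite subrr mul0r.
Qed.

Lemma iterA_parity_sign n : iter n A parity_sign 0 = 0.
Proof.
suff H v : iter n A parity_sign (- v) = - iter n A parity_sign v.
  by have := H 0; rewrite oppr0; lra.
elim: n v => [|n IHn] v /=.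
  by rewrite /parity_sign abszN sgrN rmorphN; case: odd; rewrite ?oppr0.
rewrite !opA_unitE -[- v + 1]opprK opprD opprK !IHn -opprD IHn; by field.
Qed.

Lemma sum_even (F : nat -> R) j : (forall r, F r.*2.+1 = 0) ->
  \sum_(t < j.*2.+1) F t = \sum_(r < j.+1) F r.*2.
Proof.
move=> F0; elim: j => [|j IHj]; first by rewrite !big_ord1.
by rewrite doubleS big_ord_recr big_ord_recr /= IHj F0 addr0 -doubleS [RHS]big_ord_recr.
Qed.

(** For fixed [r], the product of [2 j + 1], [cbin j] and [cbin (j - r)] tends to 2/pi, while
    [cbin r] over [2 r + 1] is the Taylor coefficient of asin. *)
Definition arcsin_term q j r : R :=
  j.*2.+1%:R / r.*2.+1%:R * (cbin j * cbin (j - r) * cbin r) * q ^+ r.*2.+1.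

(* A finite form of Sheppard's formula: as [j] grows the series tends to
   (2/pi) asin q. *)
Lemma sign_correlation q j :
  iter j.*2.+1 (op (stepAA ++ stepBB q))
    (fun p => parity_sign p.1 * parity_sign p.2) (0, 0) =
  \sum_(r < j.+1) arcsin_term q j r.
Proof.
rewrite iter_correlated big_ord_recl [X in X + _](_ : _ = 0) ?add0r; last first.
  by rewrite (iterA_parity_sign _ : iter (j.*2.+1 - ord0) A (iter ord0 B _) 0 = 0) !mulr0.
(* Level 0 has vanished by oddness. At level [t + 1], one B turns [parity_sign] into [origin], and
   absorption in the binomial coefficient gives [F t]. *)
pose F t : R := j.*2.+1%:R / t.+1%:R * q ^+ t.+1 * ('C(j.*2, t)%:R * zcoef (j.*2 - t) t ^+ 2).
have EF (t : 'I_j.*2.+1) : 'C(j.*2.+1, bump 0 t)%:R * q ^+ bump 0 t *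
    (iter (j.*2.+1 - bump 0 t) A (iter (bump 0 t) B parity_sign) 0 *
     iter (j.*2.+1 - bump 0 t) A (iter (bump 0 t) B parity_sign) 0) = F t.
  rewrite /bump add1n iterSr opD_parity_sign subSS -/(zcoef _ _) /F.
  have := mul_bin_diag j.*2.+1 t => /= /(congr1 (fun n : nat => n%:R : R)).
  rewrite !natrM => E; have t1 : t.+1%:R != 0 :> R by rewrite pnatr_eq0.
  have -> : 'C(j.*2.+1, t.+1)%:R = j.*2.+1%:R * 'C(j.*2, t)%:R / t.+1%:R :> R.
    by rewrite E mulrC mulKf.
  move: (t.+1%:R) t1 => x x0; by field.
rewrite (eq_bigr (F \o val) (fun t _ => EF t)) (@sum_even F); last first.
  by move=> r; rewrite /F zcoef_odd expr0n !mulr0.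
apply: eq_bigr => r _; have le_rj : (r <= j)%N by rewrite -ltnS.
have := zcoef_sqr (j - r) r; rewrite subnK // => E.
by rewrite /F /arcsin_term -doubleB E; ring.
Qed.

End BivariateSign.

(** * Monotonicity and numerical bounds for the arcsine sums *)

Section ArcsinSeries.
Variable R : realFieldType.
Notation cbin := (@cbin R).
Notation arcsin_term := (@arcsin_term R).

Lemma cbin_ge0 j : 0 <= cbin j. Proof. exact: ltW (cbin_gt0 _ _). Qed.
Hint Resolve cbin_ge0 : core.

Lemma cbin_le1 j : cbin j <= 1.
Proof.
elim: j => [|j IHj]; first by rewrite cbin0.
rewrite cbinS; apply: mulr_ile1; rewrite ?divr_ge0 ?ler0n //.
by rewrite ler_pdivrMr ?ltr0n // mul1r ler_nat.
Qed.

(** After clearing denominators, the two polynomial factors differ by exactly 1. *)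
Lemma cbin_sqr_incr k :
  (4 * k%:R + 1) * cbin k ^+ 2 <= (4 * k.+1%:R + 1) * cbin k.+1 ^+ 2.
Proof.
rewrite cbinS; have k0 : 0 <= k%:R :> R by rewrite ler0n.
have -> : k.*2.+1%:R = 2 * k%:R + 1 :> R by rewrite -natr1 -mul2n natrM.
have -> : k.*2.+2%:R = 2 * k%:R + 2 :> R by rewrite -addn2 natrD -mul2n natrM.
rewrite -[k.+1%:R]natr1; move: (k%:R) k0 => x x0.
rewrite [(cbin k * _) ^+ 2]exprMn [leRHS]mulrCA [leRHS]mulrC ler_wpM2r ?sqr_ge0 // expr_div_n.
rewrite mulrA ler_pdivlMr; last by rewrite exprn_gt0 //; lra.
by rewrite -subr_ge0; have -> : (4 * (x + 1) + 1) * (2 * x + 1) ^+ 2 - (4 * x + 1) * (2 * x + 2) ^+ 2 = 1; [ring | lra].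
Qed.

Definition arcsin_coef j r : R :=
  j.*2.+1%:R / r.*2.+1%:R * (cbin j * cbin (j - r) * cbin r).

Lemma arcsin_coef_ge0 j r : 0 <= arcsin_coef j r.
Proof.
by apply: mulr_ge0; [rewrite divr_ge0 ?ler0n | do 2! apply: mulr_ge0 => //].
Qed.

(** With [i = j - r], the ratio is [(2j+3)(2i+1) / ((2j+2)(2i+2))], at most 1 because [i <= j]. *)
Lemma arcsin_coefS j r : (r <= j)%N -> arcsin_coef j.+1 r <= arcsin_coef j r.
Proof.
move=> le_rj; rewrite /arcsin_coef subSn // !cbinS.
have := cbin_gt0 R j; have := cbin_gt0 R r; have := cbin_gt0 R (j - r).
set i := (j - r)%N; move: (cbin j) (cbin i) (cbin r) => x y z /ltW y0 /ltW z0 /ltW x0.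
have [a0 b0] : 0 < r.*2.+1%:R :> R /\ 0 < j.*2.+2%:R * i.*2.+2%:R :> R.
  by rewrite -natrM !ltr0n.
have -> : j.+1.*2.+1%:R / r.*2.+1%:R * (x * (j.*2.+1%:R / j.*2.+2%:R) *
    (y * (i.*2.+1%:R / i.*2.+2%:R)) * z) =
  j.*2.+1%:R / r.*2.+1%:R * (x * y * z) *
    ((j.*2.+3%:R * i.*2.+1%:R) / (j.*2.+2%:R * i.*2.+2%:R)) :> R.
  rewrite doubleS invfM.
  move: (r.*2.+1%:R^-1) (j.*2.+2%:R^-1) (i.*2.+2%:R^-1) => u v w.
  move: (j.*2.+3%:R) (j.*2.+1%:R) (i.*2.+1%:R) => p q s; ring.
rewrite -[leRHS]mulr1 ler_wpM2l //.
  by apply: mulr_ge0; [rewrite divr_ge0 ?ler0n | do 2! apply: mulr_ge0 => //].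
rewrite ler_pdivrMr // mul1r -!natrM ler_nat.
have : (i <= j)%N by rewrite leq_subr.
by nia.
Qed.

(** Decrease [j] to [r], where the coefficient is the square of [cbin r]. *)
Lemma arcsin_coef_le1 j r : (r <= j)%N -> arcsin_coef j r <= 1.
Proof.
move/subnK => <-; elim: (j - r)%N => [|d IHd].
  rewrite add0n /arcsin_coef subnn cbin0 mulr1 divff ?pnatr_eq0 // mul1r.
  by rewrite mulr_ile1 ?cbin_le1.
by apply: le_trans IHd; rewrite addSn; apply: arcsin_coefS; rewrite leq_addl.
Qed.

Lemma arcsin_termE q j r : arcsin_term q j r = arcsin_coef j r * q ^+ r.*2.+1.
Proof. by []. Qed.

Definition arcsin_sum q j : R := \sum_(r < j.+1) arcsin_term q j r.

Lemma arcsin_sumN q j : arcsin_sum (- q) j = - arcsin_sum q j.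
Proof.
rewrite /arcsin_sum -sumrN; apply: eq_bigr => r _.
by rewrite !arcsin_termE exprNn -signr_odd /= odd_double /= expr1 mulN1r mulrN.
Qed.

Variable q : R.
Hypotheses (q_gt0 : 0 < q) (q_le : q <= 1 / 2).

Let q_ge0 : 0 <= q := ltW q_gt0.

Lemma arcsin_term_ge0 j r : 0 <= arcsin_term q j r.
Proof. by rewrite arcsin_termE mulr_ge0 ?arcsin_coef_ge0 ?exprn_ge0. Qed.

Lemma arcsin_sum_ge0 j : 0 <= arcsin_sum q j.
Proof. by apply: sumr_ge0 => r _; apply: arcsin_term_ge0. Qed.

(** Passing to [j + 1] decreases the old terms but adds a new one, at most [q ^+ (2j+3)]; the
    geometric correction absorbs it because [q^3 + q^2 <= 1]. *)
Lemma arcsin_sum_decr j :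
  arcsin_sum q j.+1 + q ^+ j.+1.*2 <= arcsin_sum q j + q ^+ j.*2.
Proof.
rewrite {1}/arcsin_sum big_ord_recr /= -addrA lerD //.
  apply: ler_sum => r _; rewrite !arcsin_termE ler_wpM2r ?exprn_ge0 //.
  by apply: arcsin_coefS; rewrite -ltnS.
have -> : q ^+ j.+1.*2 = q ^+ j.*2 * q ^+ 2 by rewrite doubleS -addn2 exprD.
rewrite arcsin_termE doubleS; apply: le_trans (_ : q ^+ j.*2.+3 + q ^+ j.*2 * q ^+ 2 <= _).
  rewrite lerD2r -[leRHS]mul1r ler_wpM2r ?exprn_ge0 //.
  exact: arcsin_coef_le1.
have -> : q ^+ j.*2.+3 + q ^+ j.*2 * q ^+ 2 = q ^+ j.*2 * (q * q * q + q * q).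
  by rewrite -addn3 exprD; ring.
rewrite -[leRHS]mulr1 ler_wpM2l ?exprn_ge0 //.
have d_ge0 : 0 <= 1 / 2 - q by rewrite subr_ge0.
have := mulr_ge0 q_ge0 d_ge0; have := mulr_ge0 (mulr_ge0 q_ge0 q_ge0) d_ge0; lra.
Qed.

(** Only the term [r = 0] is kept. Its coefficient is controlled by the increasing quantity of
    [cbin_sqr_incr], whose value at index 2 is 81/64. *)
Lemma arcsin_sum_ge j : (2 <= j)%N -> q * (81 / 128) <= arcsin_sum q j.
Proof.
move=> j_ge2; rewrite /arcsin_sum big_ord_recl.
apply: le_trans (_ : arcsin_term q j 0 <= _); last first.
  by rewrite lerDl sumr_ge0 // => r _; apply: arcsin_term_ge0.
rewrite arcsin_termE /arcsin_coef subn0 cbin0 mulr1 divr1 expr1 mulrC ler_wpM2r //.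
have H i : 81 / 64 <= (4 * (i + 2)%:R + 1) * cbin (i + 2) ^+ 2.
  elim: i => [|i IHi]; last by apply: le_trans IHi _; apply: cbin_sqr_incr.
  by rewrite add0n !cbinS cbin0 -[0.*2]/0%N -[1.*2]/2%N; lra.
have H2 := H (j - 2)%N; rewrite subnK // in H2.
have -> : j.*2.+1%:R = 2 * j%:R + 1 :> R by rewrite -natr1 -mul2n natrM.
have c0 : 0 <= cbin j ^+ 2 by rewrite sqr_ge0.
rewrite -expr2; clear H; move: (cbin j ^+ 2) (j%:R) H2 c0 => x y H2 x0.
have -> : (2 * y + 1) * x = ((4 * y + 1) * x + x) / 2 by field.
by rewrite ler_pdivlMr //; lra.
Qed.

(** The coefficient of [r = 0] decreases in [j] and is below 0.66 at [j = 8]; the remaining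
    coefficients are at most 1, which leaves a geometric tail. *)
Lemma arcsin_sum_le j : (8 <= j)%N ->
  arcsin_sum q j <= q * (66 / 100) + 2 * q ^+ 3.
Proof.
move=> j_ge8; rewrite /arcsin_sum big_ord_recl lerD //.
  rewrite arcsin_termE expr1 mulrC ler_wpM2l //.
  rewrite -(subnK j_ge8); elim: (j - 8)%N => [|d IHd].
    by rewrite /arcsin_coef subn0 cbin0 !mulr1 divr1 !cbinS cbin0 -[0.*2]/0%N -[1.*2]/2%N -[2.*2]/4%N
      -[3.*2]/6%N -[4.*2]/8%N -[5.*2]/10%N -[6.*2]/12%N -[7.*2]/14%N -[8.*2]/16%N; lra.
  by apply: le_trans IHd; rewrite addSn; apply: arcsin_coefS.
apply: le_trans (_ : \sum_(r < j) q ^+ r.*2.+3 <= _).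
  apply: ler_sum => r _; rewrite arcsin_termE /= /bump add1n doubleS -[leRHS]mul1r.
  by rewrite ler_wpM2r ?exprn_ge0 // arcsin_coef_le1.
suff H i : \sum_(r < i) q ^+ r.*2.+3 + 2 * q ^+ i.*2.+3 <= 2 * q ^+ 3.
  apply: le_trans (H j); rewrite lerDl mulr_ge0 ?exprn_ge0 //.
elim: i => [|i IHi]; first by rewrite big_ord0 add0r.
apply: le_trans IHi; rewrite big_ord_recr /= -addrA lerD2l doubleS.
have -> : q ^+ i.*2.+3.+2 = q ^+ i.*2.+3 * (q * q) by rewrite -addn2 exprD.
have : 0 <= q ^+ i.*2.+3 by rewrite exprn_ge0.
have d_ge0 : 0 <= 1 / 2 - q by rewrite subr_ge0.
have := mulr_ge0 q_ge0 d_ge0 => qd; move: (q ^+ i.*2.+3) => x x0.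
have := mulr_ge0 x0 qd; have := mulr_ge0 x0 d_ge0; lra.
Qed.

End ArcsinSeries.

(** * The reference walk *)

(** Integers of [[-t, t]] that agree modulo [d + 1] are told apart by the quotients of their shifts
    by [t]. *)
Lemma floor_inj (x y z : int) (t d : nat) :
  (absz x <= t)%N -> (absz y <= t)%N ->
  (absz (x + t%:Z)%R %/ d.+1 = absz (y + t%:Z)%R %/ d.+1)%N ->
  x - y = z * d.+1%:Z -> x = y.
Proof.
move=> xt yt.
have [a Ea] : exists a : nat, x + t%:Z = a by exists (absz (x + t%:Z)); lia.
have [b Eb] : exists b : nat, y + t%:Z = b by exists (absz (y + t%:Z)); lia.
rewrite Ea Eb !absz_nat => Eab Exy.
have := divn_eq a d.+1; have := divn_eq b d.+1; rewrite Eab.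
have := ltn_pmod a (ltn0Sn d); have := ltn_pmod b (ltn0Sn d).
have [z0|z0] := eqVneq z 0; first by move: Exy; rewrite z0; lia.
have : (d.+1 <= absz (x - y)%R)%N by rewrite Exy abszM absz_nat leq_pmull // absz_gt0.
lia.
Qed.

(** * Lattice points of the reference walk in a box *)

Section Counting.
Variable m : nat.
Let T := ('I_m.+1 * 'I_m.+1 * 'I_m.+1)%type.

(** The components of [p] count the negative steps along the three axes. *)
Definition endpoint (p : T) : {ffun 'I_3 -> int} :=
  axis (inord 0) *~ (m%:Z - (p.1.1 + p.1.1)%:Z) +
  axis (inord 1) *~ (m%:Z - (p.1.2 + p.1.2)%:Z) +
  axis (inord 2) *~ (m%:Z - (p.2 + p.2)%:Z).

Lemma ffunMzE (I : finType) (f : {ffun I -> int}) (z : int) (i : I) : (f *~ z) i = f i * z.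
Proof.
case: z => n; first by rewrite -pmulrn ffunMnE -mulr_natr natz.
by rewrite NegzE mulrNz ffunE -pmulrn ffunMnE -mulr_natr natz mulrN.
Qed.

Lemma forall3 (P : pred 'I_3) :
  [forall k, P k] = [&& P (inord 0), P (inord 1) & P (inord 2)].
Proof.
apply/forallP/and3P => [H|[H0 H1 H2] k]; first by split; apply: H.
by have [->|->|->] := I3_cases k.
Qed.

Lemma box_endpoint t p : box t (endpoint p) =
  [&& (absz (p.1.2%:Z + p.1.2%:Z + p.2%:Z + p.2%:Z - m%:Z - p.1.1%:Z - p.1.1%:Z)%R <= t)%N,
      (absz (p.1.1%:Z + p.1.1%:Z + p.2%:Z + p.2%:Z - m%:Z - p.1.2%:Z - p.1.2%:Z)%R <= t)%N &
      (absz (p.1.1%:Z + p.1.1%:Z + p.1.2%:Z + p.1.2%:Z - m%:Z - p.2%:Z - p.2%:Z)%R <= t)%N].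
Proof.
rewrite /box forall3 /endpoint !ffunE !ffunMzE !ffunE !inord3_eq //=.
by congr [&& (absz _ <= t)%N, (absz _ <= t)%N & (absz _ <= t)%N]; rewrite !PoszD; ring.
Qed.

Definition endpoints t := [set p : T | box t (endpoint p)].

Hypothesis m_odd : odd m.

(** The first margin has a fixed parity, and given it the other two are fixed modulo 4. Shifted into
    [[0, 2t]], they are therefore coded by quotients by 2, 4 and 4. *)
Lemma card_endpoints_le t : (#|endpoints t| <= t.+1 * t./2.+1 * t./2.+1)%N.
Proof.
pose a0 (p : T) := absz (p.1.2%:Z + p.1.2%:Z + p.2%:Z + p.2%:Z - m%:Z - p.1.1%:Z - p.1.1%:Z + t%:Z)%R.
pose a1 (p : T) := absz (p.1.1%:Z + p.1.1%:Z + p.2%:Z + p.2%:Z - m%:Z - p.1.2%:Z - p.1.2%:Z + t%:Z)%R.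
pose a2 (p : T) := absz (p.1.1%:Z + p.1.1%:Z + p.1.2%:Z + p.1.2%:Z - m%:Z - p.2%:Z - p.2%:Z + t%:Z)%R.
pose f (p : T) : 'I_t.+1 * 'I_t./2.+1 * 'I_t./2.+1 :=
  (inord (a0 p %/ 2), inord (a1 p %/ 4), inord (a2 p %/ 4)).
have f_inj : {in endpoints t &, injective f}.
  move=> [[i0 i1] i2] [[j0 j1] j2]; rewrite !inE !box_endpoint /f /a0 /a1 /a2 /=.
  move=> /and3P[A0 A1 A2] /and3P[B0 B1 B2] [/(congr1 val) + /(congr1 val) + /(congr1 val)].
  rewrite /= !inordK; try by rewrite ?ltnS; lia.
  move=> E0 E1 E2.
  have {E0}S0 := floor_inj (z := i1%:Z + i2%:Z - i0%:Z - (j1%:Z + j2%:Z - j0%:Z)) (d := 1) A0 B0 E0.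
  have {E1}S1 := floor_inj (z := i2%:Z - j2%:Z) (d := 3) A1 B1 E1.
  have {E2}S2 := floor_inj (z := i1%:Z - j1%:Z) (d := 3) A2 B2 E2.
  have {A0 A1 A2 B0 B1 B2 S0 S1 S2} [] : i0 = j0 :> nat /\ i1 = j1 :> nat /\ i2 = j2 :> nat.
    clear f; move: (val i0) (val i1) (val i2) (val j0) (val j1) (val j2) S0 S1 S2.
    clear => a b c a' b' c' S0 S1 S2.
    by have {}S0 := S0 ltac:(ring); lia.
  by move=> E0 [E1 E2]; congr (_, _, _); apply: val_inj.
rewrite -(card_in_imset f_inj); apply: leq_trans (max_card _) _.
by rewrite !card_prod !card_ord.
Qed.

Lemma card_endpoints_ge t : (2 <= t <= m)%N -> (t.-1 * t./2.-1 * t./2.-1 <= #|endpoints t|)%N.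
Proof.
move=> /andP[t_ge2 le_tm].
(* The margins aimed at are [a0 - t], [4 x1 + r - t] and [4 x2 + r - t], where [r] is [a0] modulo 4;
   [f] solves for the step counts. The parity of [a0] makes [m - t + a0] even. *)
pose a0 (x : 'I_t.-1) := (x.*2 + ~~ odd t)%N.
pose h (x : 'I_t.-1) := ((m - t + a0 x %% 4) %/ 2)%N.
have hE x : (h x + 2 * (a0 x %/ 4) = x + (m - t + ~~ odd t) %/ 2)%N by rewrite /h /a0; lia.
have h2 x : (2 * h x = m - t + a0 x %% 4)%N by rewrite /h /a0; lia.
pose f (x : 'I_t.-1 * 'I_t./2.-1 * 'I_t./2.-1) : T :=
  (inord (h x.1.1 + x.1.2 + x.2), inord (h x.1.1 + a0 x.1.1 %/ 4 + x.2),
   inord (h x.1.1 + a0 x.1.1 %/ 4 + x.1.2)).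
have a0_le x : (a0 x + 2 <= t.*2)%N by rewrite /a0; have := ltn_ord x; lia.
have fE x : [/\ val (f x).1.1 = (h x.1.1 + x.1.2 + x.2)%N,
    val (f x).1.2 = (h x.1.1 + a0 x.1.1 %/ 4 + x.2)%N &
    val (f x).2 = (h x.1.1 + a0 x.1.1 %/ 4 + x.1.2)%N].
  have := ltn_ord x.1.2; have := ltn_ord x.2; have := a0_le x.1.1; have := h2 x.1.1.
  by rewrite /f /= => ? ? ? ?; split; rewrite inordK //; lia.
have f_inj : injective f.
  move=> [[a b] c] [[a' b'] c'] fxy.
  have [] := fE (a, b, c); have [] := fE (a', b', c'); rewrite -fxy /=.
  move=> -> -> -> e0 e1 e2.
  have Ea : a = a' by apply: val_inj => /=; have := hE a; have := hE a'; lia.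
  rewrite Ea in e0 e1 e2 *.
  by congr (_, _, _); apply: val_inj => /=; lia.
rewrite -[leqLHS](_ : #|{: 'I_t.-1 * 'I_t./2.-1 * 'I_t./2.-1}| = _); last by rewrite !card_prod !card_ord.
rewrite -(card_imset _ f_inj); apply/subset_leq_card/fintype.subsetP => p /imsetP[x _ ->].
have [e0 e1 e2] := fE x; rewrite inE box_endpoint e0 e1 e2.
have := ltn_ord x.1.2; have := ltn_ord x.2; have := a0_le x.1.1; have := h2 x.1.1.
have := divn_eq (a0 x.1.1) 4; have := ltn_pmod (a0 x.1.1) (isT : 0 < 4)%N.
move: (a0 x.1.1 %/ 4)%N (a0 x.1.1 %% 4)%N (a0 x.1.1) (h x.1.1) => y r a b.
move: (val x.1.2) (val x.2) => x1 x2 *.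
by apply/and3P; split; lia.
Qed.

End Counting.

(** * Binomial weights near the centre *)

Section CentralBinomial.
Variable R : realFieldType.
Variable j : nat.
Let m := j.*2.+1.

Definition binom_weight n i : R := 'C(n, i)%:R / 2 ^+ n.

Lemma binom_weight_ge0 n i : 0 <= binom_weight n i.
Proof. by rewrite divr_ge0 ?exprn_ge0 ?ler0n. Qed.

Lemma binom_weight_mid : binom_weight m j = cbin R j.+1.
Proof.
rewrite /binom_weight /cbin doubleS binS.
have -> : 'C(m, j.+1) = 'C(m, j) by rewrite -(@bin_sub m j.+1) /m; [congr binomial|]; lia.
have -> : 4 ^+ j.+1 = 2 * 2 ^+ m :> R.
  rewrite (_ : 4 = 2 ^+ 2); last by rewrite -natrX.
  by rewrite -exprM mul2n doubleS exprS.
by rewrite addnn -mul2n natrM invfM mulrACA divff ?mul1r ?pnatr_eq0.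
Qed.

Lemma binom_weight_sym i : (i <= m)%N -> binom_weight m (m - i) = binom_weight m i.
Proof. by move=> le_im; rewrite /binom_weight bin_sub. Qed.

Lemma binom_weight_step r : (r < j)%N ->
  binom_weight m (j - r.+1) = binom_weight m (j - r) * ((j - r)%:R / (j + r.+2)%:R).
Proof.
move=> lt_rj; rewrite /binom_weight.
have := mul_bin_left m (j - r.+1); rewrite -subSn // subSS.
have -> : (m - (j - r.+1))%N = (j + r.+2)%N by rewrite /m; lia.
move/(congr1 (fun n : nat => n%:R : R)); rewrite !natrM => E.
have d0 : (j + r.+2)%:R != 0 :> R by rewrite pnatr_eq0 addnS.
have -> : 'C(m, j - r.+1)%:R = (j - r)%:R * 'C(m, j - r)%:R / (j + r.+2)%:R :> R.
  by rewrite E mulrC mulKf.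
by move: ((j + r.+2)%:R) d0 => x x0; field; rewrite x0 expf_neq0 ?pnatr_eq0.
Qed.

(** The weight is a product of ratios, each at least [1 - 2 (i + 1) / (j + 1)]; the losses add up to
    [r (r + 1) / (j + 1)]. *)
Lemma binom_weight_near r : (r <= j)%N ->
  binom_weight m j * (1 - (r * r.+1)%:R / j.+1%:R) <= binom_weight m (j - r)
  /\ binom_weight m (j - r) <= binom_weight m j.
Proof.
elim: r => [|r IHr] lt_rj; first by rewrite subn0 mul0n mul0r subr0 mulr1 lexx.
have [lo hi] := IHr (ltnW lt_rj); rewrite binom_weight_step //.
have w0 := binom_weight_ge0 m (j - r).
have d0 : 0 < (j + r.+2)%:R :> R by rewrite ltr0n addnS.
have q1 : (j - r)%:R / (j + r.+2)%:R <= 1 :> R.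
  by rewrite ler_pdivrMr // mul1r ler_nat; lia.
split; last by apply: le_trans hi; rewrite ler_piMr.
have j0 : 0 < j.+1%:R :> R by rewrite ltr0n.
have q2 : 1 - (2 * r.+1)%:R / j.+1%:R <= (j - r)%:R / (j + r.+2)%:R :> R.
  have -> : (j - r)%:R / (j + r.+2)%:R = 1 - (2 * r.+1)%:R / (j + r.+2)%:R :> R.
    rewrite -[X in _ = X - _](divff (lt0r_neq0 d0)) -mulrBl; congr (_ / _).
    by rewrite -natrB; [congr _%:R; lia | lia].
  rewrite lerB // ler_wpM2l ?ler0n // lef_pV2 ?posrE // ler_nat; lia.
apply: le_trans (ler_wpM2l w0 q2).
have -> : (r.+1 * r.+2)%:R = (r * r.+1)%:R + (2 * r.+1)%:R :> R by rewrite -natrD; congr _%:R; lia.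
move: (binom_weight m (j - r)) (binom_weight m j) lo hi => x y lo hi.
have s0 : 0 <= (2 * r.+1)%:R / j.+1%:R :> R by rewrite divr_ge0 ?ler0n.
rewrite mulrDl; move: s0 lo; move: (_ / j.+1%:R) (_ / j.+1%:R) => a b b0 lo.
have := ler_wpM2r b0 hi; nra.
Qed.

Lemma binom_weight_le i : (i <= m)%N -> binom_weight m i <= binom_weight m j.
Proof.
move=> le_im; have [le_ij|lt_ji] := leqP i j.
  by have [_] := binom_weight_near (leq_subr i j); rewrite subKn.
have [_] := @binom_weight_near (i - j.+1) ltac:(lia).
by rewrite -(binom_weight_sym le_im); congr (binom_weight _ _ <= _); rewrite /m; lia.
Qed.

Lemma binom_weight_ge i t : (i <= m)%N -> (absz (m%:Z - (i + i)%:Z)%R <= t)%N ->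
  binom_weight m j * (1 - (t ^ 2)%:R / (2 * m%:R)) <= binom_weight m i.
Proof.
move=> le_im le_t.
(* The odd number [m - 2 i] is plus or minus [2 r + 1]; symmetry brings the index below the
   centre. *)
have [r [le_rj ir tr]] : exists r, [/\ (r <= j)%N, i = (j - r)%N \/ (m - i)%N = (j - r)%N & (r.*2.+1 <= t)%N].
  have [le_ij|lt_ji] := leqP i j.
    by exists (j - i)%N; split; [lia|left; lia|move: le_t; rewrite /m; lia].
  by exists (i - j.+1)%N; split; [lia|right; rewrite /m; lia|move: le_t; rewrite /m; lia].
have -> : binom_weight m i = binom_weight m (j - r).
  by case: ir => <- //; rewrite binom_weight_sym.
have [lo _] := binom_weight_near le_rj; apply: le_trans lo.
rewrite ler_wpM2l ?binom_weight_ge0 // lerB //.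
rewrite ler_pdivrMr ?ltr0n // mulrAC ler_pdivlMr; last by rewrite mulr_gt0 // ltr0n.
rewrite -!natrM ler_nat /m.
have t2 : (r.*2.+1 ^ 2 <= t ^ 2)%N by rewrite leq_exp2r.
have e : (4 * (r * r.+1) <= r.*2.+1 ^ 2)%N by rewrite -mul2n expnS expn1; lia.
have := leq_mul (leq_trans e t2) (leqnn j.+1).
by move: (t ^ 2)%N => y; clear; move: (r * r.+1)%N => x; rewrite -!mul2n; nia.
Qed.

Lemma cbin_sqr_le k : k.*2.+1%:R * cbin R k ^+ 2 <= 1.
Proof.
have := @arcsin_coef_le1 R k 0 isT.
by rewrite /arcsin_coef subn0 cbin0 divr1 mulr1 expr2.
Qed.

Lemma cbin_sqr_ge k : 1 <= (4 * k%:R + 1) * cbin R k ^+ 2.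
Proof.
elim: k => [|k IHk]; first by rewrite cbin0 mulr0 add0r expr1n mulr1.
exact: le_trans IHk (cbin_sqr_incr _ _).
Qed.

Definition peak : R := binom_weight m j.

Lemma peak_gt0 : 0 < peak.
Proof. by rewrite /peak binom_weight_mid cbin_gt0. Qed.

Lemma peak_sqr_le : m%:R * peak ^+ 2 <= 1.
Proof.
rewrite /peak binom_weight_mid; apply: le_trans (cbin_sqr_le j.+1).
by rewrite ler_wpM2r ?sqr_ge0 // ler_nat /m; lia.
Qed.

Lemma peak_sqr_ge : 1 <= 5 * m%:R * peak ^+ 2.
Proof.
rewrite /peak binom_weight_mid; apply: le_trans (cbin_sqr_ge j.+1) _.
by rewrite ler_wpM2r ?sqr_ge0 // -!natrM natr1 ler_nat /m; lia.
Qed.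

(** The final positions share the parity of [m], so at most [t + 1] of them lie in [[-t, t]], each
    with probability at most [peak]. *)
Lemma walk_near_origin (t : nat) :
  iter m (op (opA R unit_step tt)) (fun v => (absz v <= t)%N%:R) 0 <= t.+1%:R * peak.
Proof.
rewrite iter_opA.
apply: le_trans (_ : \sum_(i < m.+1 | (absz (m%:Z - (i + i)%:Z)%R <= t)%N) peak <= _).
  rewrite [leRHS]big_mkcond /=; apply: ler_sum => i _.
  rewrite add0r /unit_step intz; case: (_ <= _)%N; last by rewrite mulr0.
  by rewrite mulr1; apply: binom_weight_le; rewrite -ltnS.
rewrite sumr_const -[peak *+ _]mulr_natl ler_wpM2r ?(ltW peak_gt0) // ler_nat.
pose f (i : 'I_m.+1) : 'I_t.+1 := inord (absz (m%:Z - (i + i)%:Z + t%:Z)%R %/ 2).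
have f_inj : {in [pred i : 'I_m.+1 | (absz (m%:Z - (i + i)%:Z)%R <= t)%N] &, injective f}.
  move=> a b; rewrite !inE => A B /(congr1 val); rewrite /= !inordK; try by rewrite ltnS; lia.
  move=> E; apply: val_inj => /=.
  by have := floor_inj (z := b%:Z - a%:Z) (d := 1) A B E; lia.
rewrite -(card_in_image f_inj); apply: leq_trans (max_card _) _.
by rewrite card_ord.
Qed.

End CentralBinomial.

Lemma cube_half a h : (a * (2 * h) * (2 * h) = a * h * h * 4)%N.
Proof. by lia. Qed.

(** * Probability that the reference walk ends in a box *)

Section MeanWalk.
Variable R : realFieldType.
Variable j : nat.
Let m := j.*2.+1.

Lemma mean_walkE (psi : {ffun 'I_3 -> int} -> R) :
  mean_walk m psi = \sum_(p : 'I_m.+1 * 'I_m.+1 * 'I_m.+1) binom_weight R m p.1.1 * binom_weight R m p.1.2 *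
     binom_weight R m p.2 * psi (@endpoint m p).
Proof.
rewrite /mean_walk !opAs_cat !opAs_nseq iter_opA -(pair_bigA _ (fun (p : 'I_m.+1 * 'I_m.+1) (i2 : 'I_m.+1) =>
   binom_weight R m p.1 * binom_weight R m p.2 *
     binom_weight R m i2 * psi (@endpoint m (p, i2)))).
rewrite -(pair_bigA _ (fun i0 i1 : 'I_m.+1 => \sum_(i2 < m.+1) binom_weight R m i0 * binom_weight R m i1 *
     binom_weight R m i2 * psi (@endpoint m ((i0, i1), i2)))).
apply: eq_bigr => i0 _. rewrite iter_opA mulr_sumr; apply: eq_bigr => i1 _.
rewrite iter_opA !mulr_sumr; apply: eq_bigr => i2 _.
by rewrite add0r !mulrA.
Qed.

Lemma mean_walk_box_le t : mean_walk m (fun v => (box t v)%:R) <= peak R j ^+ 3 * ((t + 2)%:R ^+ 3 / 4).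
Proof.
rewrite mean_walkE.
apply: le_trans (_ : \sum_(p in endpoints m t) peak R j ^+ 3 <= _).
  rewrite [leRHS]big_mkcond /=; apply: ler_sum => p _; rewrite inE.
  case: (box _ _); last by rewrite mulr0.
  have le_ord (i : 'I_m.+1) : (i <= m)%N by rewrite -ltnS.
  rewrite mulr1 !exprS expr0 mulr1 mulrA.
  have w0 i := binom_weight_ge0 R m i.
  have w1 (i : 'I_m.+1) : binom_weight R m i <= peak R j by apply: binom_weight_le.
  by apply: ler_pM => //; [apply: mulr_ge0 | apply: ler_pM].
rewrite sumr_const -[_ *+ #|_|]mulr_natr ler_wpM2l ?exprn_ge0 ?(ltW (peak_gt0 _ _)) //.
rewrite ler_pdivlMr // -natrX -natrM ler_nat.
have m_odd : odd m by rewrite /m /= odd_double.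
have H := card_endpoints_le m_odd t.
apply: leq_trans (_ : (t.+1 * t./2.+1 * t./2.+1 * 4 <= _)%N); first by rewrite leq_mul2r H orbT.
rewrite -cube_half !expnS expn0 muln1 [leqRHS]mulnA; apply: leq_mul; first apply: leq_mul; lia.
Qed.

Lemma mean_walk_box_ge t : (3 <= t <= m)%N ->
  (peak R j * (1 - (t ^ 2)%:R / (2 * m%:R))) ^+ 3 * ((t - 3)%:R ^+ 3 / 4) <=
  mean_walk m (fun v => (box t v)%:R).
Proof.
move=> /andP[t_ge3 le_tm]; set e := 1 - _ / _; rewrite mean_walkE.
have w0 i := binom_weight_ge0 R m i.
have m0 : 0 < 2 * m%:R :> R by rewrite mulr_gt0 // ltr0n.
have [e_ge0|/ltW e_le0] := lerP 0 e; last first.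
  apply: le_trans (_ : 0 <= _).
    rewrite mulr_le0_ge0 ?mulr_ge0 ?exprn_ge0 ?ler0n ?invr_ge0 //.
    by rewrite exprMn mulr_ge0_le0 ?exprn_ge0 ?(ltW (peak_gt0 _ _)) // exprn_odd_le0.
  apply: sumr_ge0 => p _; apply: mulr_ge0; last exact: ler0n.
  by apply: mulr_ge0 => //; apply: mulr_ge0.
apply: le_trans (_ : \sum_(p in endpoints m t) (peak R j * e) ^+ 3 <= _); last first.
  rewrite [leLHS]big_mkcond /=; apply: ler_sum => p _; rewrite inE.
  case: ifP => [bp|_]; last first.
    by rewrite mulr0.
  have le_ord (i : 'I_m.+1) : (i <= m)%N by rewrite -ltnS.
  (* Up to sign, each displacement [m - 2 i] along an axis is half the sum of two margins, hence
     bounded by [t]. *)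
  have [D0 D1 D2] : [/\ (absz (m%:Z - (p.1.1 + p.1.1)%:Z)%R <= t)%N,
    (absz (m%:Z - (p.1.2 + p.1.2)%:Z)%R <= t)%N & (absz (m%:Z - (p.2 + p.2)%:Z)%R <= t)%N].
    by move: bp; rewrite box_endpoint => /and3P[? ? ?]; split; lia.
  have pe0 : 0 <= peak R j * e by rewrite mulr_ge0 // ltW ?peak_gt0.
  rewrite mulr1 !exprS expr0 mulr1 mulrA.
  have W0 := binom_weight_ge R (le_ord p.1.1) D0; have W1 := binom_weight_ge R (le_ord p.1.2) D1.
  have W2 := binom_weight_ge R (le_ord p.2) D2.
  by apply: ler_pM => //; [apply: mulr_ge0 | apply: ler_pM].
rewrite sumr_const -[_ *+ #|_|]mulr_natr ler_wpM2l ?exprn_ge0 //.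
  by rewrite mulr_ge0 // ltW ?peak_gt0.
rewrite ler_pdivrMr // -natrX -natrM ler_nat.
have m_odd : odd m by rewrite /m /= odd_double.
have H := card_endpoints_ge m_odd (t := t).
apply: leq_trans (_ : (t.-1 * t./2.-1 * t./2.-1 * 4 <= _)%N); last first.
  by rewrite leq_mul2r H ?orbT // le_tm andbT (ltnW t_ge3).
rewrite -cube_half !expnS expn0 muln1 [leqLHS]mulnA; apply: leq_mul; first apply: leq_mul; lia.
Qed.

End MeanWalk.

(** * The conditional probability for fixed size *)

(** Independence of the groups turns the average over all of them into iterates of the one-group
    operator. *)
Lemma avg_walk (R : realFieldType) (V : zmodType) (X B : finType) (f : X -> B -> V)
    (l : seq (R * V)) :
  (forall psi v, avg (fun x => avg (fun b => psi (v + f x b))) = op l psi v) ->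
  forall m psi v,
  avg (fun c : {ffun 'I_m -> X} => avg (fun b : {ffun 'I_m -> B} =>
    psi (v + \sum_i f (c i) (b i)))) = iter m (op l) psi v.
Proof.
move=> fl; elim=> [|m IHm] psi v.
  have e (J : finType) : {ffun 'I_0 -> J} by apply: finfun => -[].
  by rewrite !(avg_ffun0 _ (e _)) big_ord0 addr0.
rewrite avg_ffunS -[RHS]/(op l (iter m (op l) psi) v) -fl; apply: eq_avg => x.
under eq_avg => c do rewrite avg_ffunS.
rewrite exchange_avg; apply: eq_avg => b; rewrite -IHm.
apply: eq_avg => c; apply: eq_avg => b'.
rewrite big_ord_recl !ffun_cons0 addrA; congr (psi (_ + _)).
by apply: eq_bigr => i _; rewrite !ffun_consS.
Qed.

Lemma opAs_le (R : realFieldType) (V : zmodType) (K : finType) (delta : K -> V) w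
    (phi psi : V -> R) : (forall v, phi v <= psi v) ->
  forall v, opAs delta w phi v <= opAs delta w psi v.
Proof.
move=> le_pp; elim: w => //= k w IHw v.
by rewrite !opAE ler_wpM2r ?invr_ge0 ?ler0n // lerD.
Qed.

Definition axes_sign (x : 'I_3 * 'I_3 * 'I_3) (k : 'I_3) : int :=
  axis x.1.1 k * axis x.1.2 k * axis x.2 k.

(** This is the product of the three votes of a group in comparison [k]; it depends on the signs
    only through their parity. *)
Definition product_step (k : 'I_3) (x : 'I_3 * 'I_3 * 'I_3) (b : bool * bool * bool) : int :=
  sgb (parity b) * axes_sign x k.

Definition product_sum m (c : {ffun 'I_m -> 'I_3 * 'I_3 * 'I_3}) (e : {ffun 'I_m -> bool})
    (k : 'I_3) : int := \sum_i sgb (e i) * axes_sign (c i) k.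

Lemma axisE k l : axis k l = if l == k then 1 else -1.
Proof. by rewrite ffunE. Qed.

Lemma axes_sign_pm x k : axes_sign x k = 1 \/ axes_sign x k = -1.
Proof.
by rewrite /axes_sign !axisE; do 3! case: (_ == _); rewrite ?mulrN1 ?mul1r ?opprK; auto.
Qed.

(** Here [d] is the probability of closeness, and [a], [A], [B] those of closeness together with
    agreement, with equal product signs and with a near tie; [g] and [h] are the unconditional
    probabilities of the last two. *)
Lemma ratio_error (R : realFieldType) (a d g h H x y e A B : R) :
  0 <= g -> g <= 1 -> 0 <= y -> x <= y -> 0 <= e -> h <= H ->
  x - e <= d -> d <= y + e -> g * x - e <= A -> A <= g * y + e ->
  B <= h * y + e -> a <= A + B -> A <= a + B ->
  `|a - g * d| <= y - x + H * y + 3%:R * e.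
Proof.
move=> g0 g1 y0 xy e0 hH dL dU AL AU BU aU aL.
have hy : h * y <= H * y by rewrite ler_wpM2r.
have gdL : g * (x - e) <= g * d by rewrite ler_wpM2l.
have gdU : g * d <= g * (y + e) by rewrite ler_wpM2l.
have gyx : g * (y - x) <= y - x by rewrite ler_piMl // subr_ge0.
have ge : g * e <= e by rewrite ler_piMl.
rewrite ler_norml; apply/andP; split; lra.
Qed.

(** * Laws of the sums of products, and conditioning on closeness *)

Section ProductLaws.
Variable R : realFieldType.

Lemma product_stepE k (psi : int -> R) v :
  avg (fun x => avg (fun b => psi (v + product_step k x b))) =
  op (opA R unit_step tt) psi v.
Proof.
rewrite opA_unitE (eq_avg (G := fun=> (psi (v + 1) + psi (v - 1)) / 2)).
  by rewrite avg_cst // !card_prod card_ord.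
move=> x; rewrite !avg_pair !avg_bool /product_step /parity /=.
by have [->|->] := axes_sign_pm x k; rewrite /sgb ?mulr1 ?mulrN1 ?opprK; field.
Qed.

Lemma avg_axis_pair k l (h : int -> int -> R) : k != l ->
  avg (fun a => h (axis a k) (axis a l)) = (h 1 (-1) + h (-1) 1 + h (-1) (-1)) / 3%:R.
Proof.
rewrite avg_I3 !axisE.
by have [->|->|->] := I3_cases k; have [->|->|->] := I3_cases l;
  rewrite ?eqxx // !inord3_eq //= => _; field.
Qed.

(** Two coordinates of a random axis are equally likely to be [(1, -1)], [(-1, 1)] and [(-1, -1)],
    so their product has mean -1/3; three independent voters give the cube, -1/27. *)
Lemma product_step2E k l (psi : int * int -> R) v : k != l ->
  avg (fun x => avg (fun b => psi (v + (product_step k x b, product_step l x b)))) =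
  op (stepAA R ++ stepBB (- (1 / 27%:R))) psi v.
Proof.
move=> kl; pose g (a a' : int) := (psi (v + (a, a')) + psi (v + (- a, - a'))) / 2.
(* The parity is an unbiased sign common to both comparisons; averaging over it symmetrises
   [psi]. *)
rewrite (eq_avg (G := fun x => g (axes_sign x k) (axes_sign x l))); last first.
  move=> x; rewrite !avg_pair !avg_bool /product_step /parity /=.
  by rewrite /g /sgb !mul1r !mulN1r; field.
rewrite !avg_pair.
under eq_avg => x0 do under eq_avg => x1 do
  rewrite (avg_axis_pair (fun a a' => g (axis x0 k * axis x1 k * a) (axis x0 l * axis x1 l * a')) kl).
under eq_avg => x0 do
  rewrite (avg_axis_pair (fun a a' => (g (axis x0 k * a * 1) (axis x0 l * a' * - 1) +
    g (axis x0 k * a * -1) (axis x0 l * a' * 1) + g (axis x0 k * a * -1) (axis x0 l * a' * -1)) / 3%:R) kl).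
rewrite (avg_axis_pair (fun a a' =>
    ((g (a * 1 * 1) (a' * -1 * -1) + g (a * 1 * -1) (a' * -1 * 1) + g (a * 1 * -1) (a' * -1 * -1)) / 3%:R +
     (g (a * -1 * 1) (a' * 1 * -1) + g (a * -1 * -1) (a' * 1 * 1) + g (a * -1 * -1) (a' * 1 * -1)) / 3%:R +
     (g (a * -1 * 1) (a' * -1 * -1) + g (a * -1 * -1) (a' * -1 * 1) + g (a * -1 * -1) (a' * -1 * -1)) / 3%:R) / 3%:R) kl).
rewrite !(mulr1, mul1r, mulrN1, mulN1r, opprK) /g !opprK.
rewrite /op /stepAA /stepBB !big_cons big_nil /=; by field.
Qed.

Variable j : nat.
Let m := j.*2.+1.
Let XS := {ffun 'I_m -> 'I_3 * 'I_3 * 'I_3}.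
Let BS := {ffun 'I_m -> bool * bool * bool}.

Definition expect (G : XS -> BS -> R) : R := avg (fun c => avg (G c)).

Lemma product_sumE (c : XS) (b : BS) k :
  product_sum c (parities b) k = \sum_i product_step k (c i) (b i).
Proof. by apply: eq_bigr => i _; rewrite ffunE. Qed.

Lemma odd_product_sum (c : XS) e k : odd (absz (product_sum c e k)).
Proof.
rewrite /product_sum; have : odd m by rewrite /= odd_double.
have H (n : nat) (f : 'I_n -> int) : (forall i, odd (absz (f i))) -> odd (absz (\sum_i f i)) = odd n.
  elim: n f => [|n IHn] f fo; first by rewrite big_ord0.
  have := IHn (fun i => f (lift ord0 i)) (fun i => fo _); have := fo ord0.
  by rewrite big_ord_recl /=; lia.
move=> mo; rewrite H // => i.
by have [->|->] := axes_sign_pm (c i) k; case: (e i).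
Qed.

Lemma expect_sign2 k l : k != l ->
  expect (fun c b => parity_sign R (product_sum c (parities b) k) *
                     parity_sign R (product_sum c (parities b) l))
  = - arcsin_sum (1 / 27%:R) j.
Proof.
move=> kl; rewrite -arcsin_sumN /arcsin_sum -sign_correlation.
rewrite -(avg_walk (fun psi v => product_step2E psi v kl)).
apply: eq_avg => c; apply: eq_avg => b; rewrite add0r !product_sumE.
have -> : \sum_i (product_step k (c i) (b i), product_step l (c i) (b i)) =
  (\sum_i product_step k (c i) (b i), \sum_i product_step l (c i) (b i)).
  by elim/big_rec3: _ => //= i z1 z2 z3 _ ->.
by [].
Qed.

Lemma expect_near_tie k t :
  expect (fun c b => (absz (product_sum c (parities b) k) <= t)%N%:R) <= t.+1%:R * peak R j.
Proof.
apply: le_trans (walk_near_origin R j t); rewrite -/m -(avg_walk (product_stepE k)) le_eqVlt.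
by apply/orP; left; apply/eqP; apply: eq_avg => c; apply: eq_avg => b; rewrite add0r product_sumE.
Qed.

Definition all_same (c : XS) (e : {ffun 'I_m -> bool}) : bool :=
  (Num.sg (product_sum c e (inord 0)) == Num.sg (product_sum c e (inord 1))) &&
  (Num.sg (product_sum c e (inord 1)) == Num.sg (product_sum c e (inord 2))).

Definition near_tie t (c : XS) (e : {ffun 'I_m -> bool}) : bool :=
  [exists k, (absz (product_sum c e k) <= t)%N].

Lemma expectD F G : expect (fun c b => F c b + G c b) = expect F + expect G.
Proof. by rewrite /expect -avgD; apply: eq_avg => c; rewrite avgD. Qed.

Lemma expectZ a F : expect (fun c b => a * F c b) = a * expect F.
Proof. by rewrite /expect -avgZ; apply: eq_avg => c; rewrite avgZ. Qed.

Lemma expect_cst a : expect (fun _ _ => a) = a.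
Proof. by rewrite /expect !avg_cst // ?cardXs_gt0 ?cardBs_gt0. Qed.

Lemma ler_expect F G : (forall c b, F c b <= G c b) -> expect F <= expect G.
Proof. by move=> leFG; apply: ler_avg => c; apply: ler_avg. Qed.

Lemma eq_expect F G : (forall c b, F c b = G c b) -> expect F = expect G.
Proof. by move=> eqFG; apply: eq_avg => c; apply: eq_avg. Qed.

(** The indicator that three signs coincide is a quarter of 1 plus their three pairwise products. *)
Lemma expect_all_same :
  expect (fun c b => (all_same c (parities b))%:R) =
  (1 - 3%:R * arcsin_sum (1 / 27%:R) j) / 4.
Proof.
pose s k := fun (c : XS) (b : BS) => parity_sign R (product_sum c (parities b) k).
have -> : expect (fun c b => (all_same c (parities b))%:R) =
   expect (fun c b => 4^-1 * (1 + (s (inord 0) c b * s (inord 1) c b +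
     (s (inord 1) c b * s (inord 2) c b + s (inord 0) c b * s (inord 2) c b)))).
  apply: eq_expect => c b; rewrite /s /parity_sign !odd_product_sum /all_same.
  have sg k : Num.sg (product_sum c (parities b) k) = 1 \/ Num.sg (product_sum c (parities b) k) = -1.
    move: (odd_product_sum c (parities b) k); move: (product_sum _ _ _) => z.
    have [z0|z0|->] := ltrgt0P z => // _; [left|right]; [exact: gtr0_sg|exact: ltr0_sg].
  by case: (sg (inord 0)) => ->; case: (sg (inord 1)) => ->; case: (sg (inord 2)) => -> /=; field.
rewrite expectZ expectD expect_cst !expectD !expect_sign2 ?inord3_eq //; by field.
Qed.

Lemma expect_near_tie_le t :
  expect (fun c b => (near_tie t c (parities b))%:R) <= 3%:R * (t.+1%:R * peak R j).
Proof.
pose n k := fun (c : XS) (b : BS) => (absz (product_sum c (parities b) k) <= t)%N%:R : R.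
apply: le_trans (_ : expect (fun c b => n (inord 0) c b + (n (inord 1) c b + n (inord 2) c b)) <= _).
  apply: ler_expect => c b; rewrite /n /near_tie -!natrD ler_nat.
  case: existsP => // -[k]; have [->|->|->] := I3_cases k => -> /=; rewrite ?addn1; lia.
rewrite !expectD (_ : 3%:R * _ = t.+1%:R * peak R j + (t.+1%:R * peak R j + t.+1%:R * peak R j)); last by ring.
by rewrite !lerD ?expect_near_tie.
Qed.

Section Close.
Variables (L T : nat) (s x y : R).
Hypotheses (L_gt0 : (0 < L)%N) (s_gt0 : 0 < s) (s2 : s ^+ 2 = m%:R).
Hypothesis (le_LT : (18 * L <= T)%N).
Hypothesis y_ge : mean_walk m (fun v => (box (T + 18 * L) v)%:R) <= y.
Hypothesis x_le : x <= mean_walk m (fun v => (box (T - 18 * L) v)%:R).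
Notation eta := (decoupling_error m L s).

Let close (c : XS) (b : BS) : R := (box T (walk axis c b))%:R.

Lemma box_bounded t : bounded 1 (fun v => (box t v)%:R : R).
Proof. by move=> v; case: (box t v); rewrite ?normr0 ?normr1. Qed.

(** The smoothed indicator of the box [T + 9 L] lies between the indicators of the boxes [T] and
    [T + 18 L]; [decoupling] applies to it. *)
Lemma expect_close_le (F : XS -> {ffun 'I_m -> bool} -> R) :
  (forall c e, 0 <= F c e <= 1) ->
  expect (fun c b => F c (parities b) * close c b) <=
  expect (fun c b => F c (parities b)) * y + eta.
Proof.
move=> F01; have F1 c e : `|F c e| <= 1.
  by have /andP[F0 ?] := F01 c e; rewrite ger0_norm.
have F0 : 0 <= expect (fun c b => F c (parities b)).
  by rewrite -(expect_cst 0); apply: ler_expect => c b; have /andP[] := F01 c (parities b).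
have := decoupling L_gt0 s_gt0 s2 (box_bounded (T + 9 * L)) F1.
rewrite -/(expect _) => /(le_trans (ler_norm _)).
rewrite lerBlDl => H; apply: le_trans (le_trans H _).
  apply: ler_expect => c b; rewrite ler_wpM2l //; first by have /andP[] := F01 c (parities b).
  exact: smooth_ge_box.
rewrite lerD2r ler_wpM2l //; apply: le_trans y_ge; apply: opAs_le => v.
have -> : (T + 18 * L = (T + 9 * L) + 9 * L)%N by lia.
exact: smooth_le_box.
Qed.

Lemma expect_close_ge (F : XS -> {ffun 'I_m -> bool} -> R) :
  (forall c e, 0 <= F c e <= 1) ->
  expect (fun c b => F c (parities b)) * x - eta <=
  expect (fun c b => F c (parities b) * close c b).
Proof.
move=> F01; have F1 c e : `|F c e| <= 1.
  by have /andP[F0 ?] := F01 c e; rewrite ger0_norm.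
have F0 : 0 <= expect (fun c b => F c (parities b)).
  by rewrite -(expect_cst 0); apply: ler_expect => c b; have /andP[] := F01 c (parities b).
have := decoupling L_gt0 s_gt0 s2 (box_bounded (T - 9 * L)) F1.
rewrite -/(expect _) distrC => /(le_trans (ler_norm _)).
rewrite lerBlDl -lerBlDr => H; apply: le_trans (le_trans _ H) _.
  rewrite lerD2r ler_wpM2l //; apply: le_trans x_le _; apply: opAs_le => v.
  have -> : (T - 9 * L = (T - 18 * L) + 9 * L)%N by lia.
  exact: smooth_ge_box.
apply: ler_expect => c b; rewrite ler_wpM2l //; first by have /andP[] := F01 c (parities b).
apply: le_trans (smooth_le_box R L_gt0 (T - 9 * L) (walk axis c b)) _.
by rewrite /close subnK //; lia.
Qed.

(** Agreement can differ from [all_same] only on near ties. These depend only on axes and parities,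
    so they too decouple from closeness and contribute at most their small probability times [y],
    plus an error. *)
Lemma conditional_bound (agree : XS -> BS -> bool) :
  0 <= x -> eta < x ->
  (forall (c : XS) (b : BS), box T (walk axis c b) -> ~~ near_tie T c (parities b) ->
     agree c b = all_same c (parities b)) ->
  `|expect (fun c b => (agree c b)%:R * close c b) / expect close
    - (1 - 3%:R * arcsin_sum (1 / 27%:R) j) / 4|
  <= (y - x + 3%:R * (T.+1%:R * peak R j) * y + 3%:R * eta) / (x - eta).
Proof.
move=> x_ge0 eta_x agreeE; rewrite -expect_all_same.
set a := expect (fun c b => (agree c b)%:R * _); set d := expect close.
set g := expect _.
pose h := expect (fun c b => (near_tie T c (parities b))%:R).
have F01 (P : XS -> {ffun 'I_m -> bool} -> bool) c e : 0 <= ((P c e)%:R : R) <= 1.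
  by case: (P c e); rewrite ?lexx ?ler01.
have gU := expect_close_le (F01 all_same); have gL := expect_close_ge (F01 all_same).
have hU := expect_close_le (F01 (near_tie T)).
have dU : d <= y + eta.
  have := expect_close_le (F01 (fun _ _ => true)); rewrite expect_cst mul1r.
  by rewrite (eq_expect (G := close)) // => c b; rewrite mul1r.
have dL : x - eta <= d.
  have := expect_close_ge (F01 (fun _ _ => true)); rewrite expect_cst mul1r.
  by rewrite (eq_expect (G := close)) // => c b; rewrite mul1r.
rewrite -/g -/h in gU gL hU.
have aU : a <= expect (fun c b => (all_same c (parities b))%:R * close c b) +
    expect (fun c b => (near_tie T c (parities b))%:R * close c b).
  rewrite -expectD; apply: ler_expect => c b; rewrite /close.
  case: (boolP (box _ _)) => [bx|_]; last by rewrite !mulr0 addr0.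
  have := agreeE c b bx; rewrite !mulr1 -natrD ler_nat.
  by case: (near_tie _ _ _) => [_|->] //=; [case: (agree c b); rewrite addn1 | rewrite addn0].
have aL : expect (fun c b => (all_same c (parities b))%:R * close c b) <=
    a + expect (fun c b => (near_tie T c (parities b))%:R * close c b).
  rewrite -expectD; apply: ler_expect => c b; rewrite /close.
  case: (boolP (box _ _)) => [bx|_]; last by rewrite !mulr0 addr0.
  have := agreeE c b bx; rewrite !mulr1 -natrD ler_nat.
  by case: (near_tie _ _ _) => [_|->] //=; [case: (all_same _ _); rewrite addn1 | rewrite addn0].
have hle : h <= 3%:R * (T.+1%:R * peak R j) := expect_near_tie_le T.
set H := 3%:R * (T.+1%:R * peak R j) in hle *.
have [g0 g1] : 0 <= g /\ g <= 1.
  rewrite -(expect_cst 0) -(expect_cst 1).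
  by split; apply: ler_expect => c b; have /andP[] := F01 all_same c (parities b).
have eta0 : 0 <= eta.
  by rewrite addr_ge0 // !mulr_ge0 ?ler0n ?invr_ge0 ?exprn_ge0 ?ler0n // ltW.
have d0 : 0 < d by apply: lt_le_trans dL; rewrite subr_gt0.
have y0 : x <= y.
  apply: le_trans x_le (le_trans _ y_ge); apply: opAs_le => v; rewrite ler_nat.
  case: (boolP (box (T - _) v)) => // /forallP bv; rewrite lt0b; apply/forallP => k.
  exact: leq_trans (bv k) (leq_trans (leq_subr _ _) (leq_addr _ _)).
have -> : a / d - g = (a - g * d) / d by rewrite mulrBl mulfK ?gt_eqF.
rewrite normrM [`|d^-1|]ger0_norm ?invr_ge0 ?(ltW d0) //.
have num := ratio_error g0 g1 (le_trans x_ge0 y0) y0 eta0 hle dL dU gL gU hU aU aL.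
apply: ler_pM => //; first by rewrite invr_ge0 ltW.
by rewrite lef_pV2 ?posrE // subr_gt0.
Qed.

End Close.
End ProductLaws.

(** * From rankings to signed axes *)

Definition next_alt (k : 'I_3) : alternative := inord (k.+1 %% 3).

Definition prefers_next (r : ranking) (k : 'I_3) : bool := prefers r k (next_alt k).

Lemma prefers_nextE r : [/\ prefers_next r (inord 0) = prefers r alt_a alt_b,
  prefers_next r (inord 1) = prefers r alt_b alt_c &
  prefers_next r (inord 2) = prefers r alt_c alt_a].
Proof. by rewrite /prefers_next /next_alt !inordK. Qed.

(* A ranking is determined by the comparison that differs from the two others
   around the cycle a, b, c, together with the outcome of that comparison. *)
Definition encode (r : ranking) : 'I_3 * bool :=
  let x k := prefers_next r (inord k) in
  if x 1%N == x 2%N then (inord 0, x 0%N)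
  else if x 0%N == x 2%N then (inord 1, x 1%N) else (inord 2, x 2%N).

(** The position of an alternative is the number of alternatives preferred to it, read off its two
    comparisons. *)
Lemma ranking_positions (r : ranking) :
  let x k := prefers_next r (inord k) in
  [/\ r (inord 0) = ~~ x 0%N + x 2%N :> nat,
      r (inord 1) = x 0%N + ~~ x 1%N :> nat &
      r (inord 2) = x 1%N + ~~ x 2%N :> nat]%N.
Proof.
rewrite /=; have [-> -> ->] := prefers_nextE r; rewrite /prefers /alt_a /alt_b /alt_c /=.
have D (a b : 'I_3) : a != b -> r a != r b :> nat.
  by apply: contraNneq => /val_inj/perm_inj ->.
have := D (inord 0) (inord 1); have := D (inord 1) (inord 2); have := D (inord 2) (inord 0).
rewrite !inord3_eq // => /(_ isT) + /(_ isT) + /(_ isT).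
have := ltn_ord (r (inord 0)); have := ltn_ord (r (inord 1)); have := ltn_ord (r (inord 2)).
move: (nat_of_ord (r (inord 0))) (nat_of_ord (r (inord 1))) (nat_of_ord (r (inord 2))) => a b c.
by split; lia.
Qed.

Lemma encodeP r k :
  (if prefers_next r k then 1 else -1) = axis (encode r).1 k * sgb (encode r).2.
Proof.
(* Three equal comparisons would form a cycle, and the first two alternatives would share a
   position. *)
have: ~~ ((prefers_next r (inord 0) == prefers_next r (inord 1)) &&
           (prefers_next r (inord 1) == prefers_next r (inord 2))).
  apply/negP => /andP[/eqP e01 /eqP e12].
  have [] := ranking_positions r; rewrite e01 e12 => r0 r1 _.
  have /perm_inj/eqP : r (inord 0) = r (inord 1).
    by apply: val_inj; rewrite /= r0 r1 addnC.
  by rewrite inord3_eq.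
rewrite /encode /= axisE; have [->|->|->] := I3_cases k.
all: case: (prefers_next r (inord 0)); case: (prefers_next r (inord 1));
  by case: (prefers_next r (inord 2)); rewrite //= !inord3_eq.
Qed.

Lemma encode_inj : injective encode.
Proof.
move=> r r' err'; have E k : prefers_next r k = prefers_next r' k.
  have := encodeP r k; rewrite err' -encodeP.
  by case: (prefers_next r k); case: (prefers_next r' k).
apply/permP => k; apply: val_inj.
have [a0 a1 a2] := ranking_positions r; have [b0 b1 b2] := ranking_positions r'.
by have [->|->|->] := I3_cases k; rewrite /= ?a0 ?a1 ?a2 ?b0 ?b1 ?b2 !E.
Qed.

Lemma card_ranking : #|{: ranking}| = 6.
Proof. by rewrite card_Sn. Qed.

(** * Profiles as families of axes and signs *)

Section Groups.
Variable m : nat.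

Definition group_axes (p : profile (3 * m)) : {ffun 'I_m -> 'I_3 * 'I_3 * 'I_3} :=
  [ffun i => ((encode (p (voter i (inord 0)))).1, (encode (p (voter i (inord 1)))).1,
              (encode (p (voter i (inord 2)))).1)].

Definition group_signs (p : profile (3 * m)) : {ffun 'I_m -> bool * bool * bool} :=
  [ffun i => ((encode (p (voter i (inord 0)))).2, (encode (p (voter i (inord 1)))).2,
              (encode (p (voter i (inord 2)))).2)].

Lemma voter_surj (v : 'I_(3 * m)) : exists i j, v = voter i j.
Proof.
have lt1 : (v %/ 3 < m)%N by have := ltn_ord v; lia.
exists (Ordinal lt1), (inord (v %% 3)); apply: val_inj => /=.
by rewrite inordK ?ltn_mod // (mulnC 3 (v %/ 3)%N); exact: divn_eq.
Qed.

(** Injectivity comes from [encode_inj], and the cardinalities agree because 6 = 3 * 2. *)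
Lemma groups_bij : bijective (fun p => (group_axes p, group_signs p)).
Proof.
apply: inj_card_bij => [p q [/ffunP ea /ffunP es]|].
  apply/ffunP => v; have [i [j ->]] := voter_surj v.
  have := ea i; have := es i; rewrite !ffunE => -[s0 s1 s2] [a0 a1 a2].
  by apply: encode_inj; have [->|->|->] := I3_cases j; apply: injective_projections.
rewrite card_prod !card_ffun !card_prod !card_ord card_bool card_ranking.
by rewrite -expnMn expnM.
Qed.

Lemma sum_voters (x : 'I_(3 * m) -> int) :
  \sum_v x v = \sum_i (x (voter i (inord 0)) + x (voter i (inord 1)) + x (voter i (inord 2))).
Proof.
have bij_voter : bijective (fun ij : 'I_m * 'I_3 => voter ij.1 ij.2).
  apply: inj_card_bij => [[i j] [i' j'] /(congr1 val) /=|]; last by rewrite card_prod !card_ord mulnC.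
  have := ltn_ord j; have := ltn_ord j' => ? ? E.
  by congr (_, _); apply: val_inj => /=; lia.
rewrite (reindex (fun ij : 'I_m * 'I_3 => voter ij.1 ij.2)) /=; last exact: onW_bij.
rewrite -(pair_bigA _ (fun i j => x (voter i j))) /=; apply: eq_bigr => i _.
rewrite !big_ord_recl big_ord0 addr0 addrA.
by congr (x (voter _ _) + x (voter _ _) + x (voter _ _)); apply: val_inj; rewrite /= inordK.
Qed.

Lemma voteE (p : profile (3 * m)) k v :
  vote k (next_alt k) p v = axis (encode (p v)).1 k * sgb (encode (p v)).2.
Proof. by rewrite -encodeP. Qed.

Lemma group_stepE (x : 'I_3 * 'I_3 * 'I_3) b k : group_step axis x b k =
  axis x.1.1 k * sgb b.1.1 + axis x.1.2 k * sgb b.1.2 + axis x.2 k * sgb b.2.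
Proof. by rewrite /group_step !ffunE !ffunMzE !ffunE. Qed.

Lemma group_voteE (p : profile (3 * m)) k i :
  vote k (next_alt k) p (voter i (inord 0)) + vote k (next_alt k) p (voter i (inord 1))
    + vote k (next_alt k) p (voter i (inord 2)) =
  group_step axis (group_axes p i) (group_signs p i) k.
Proof. by rewrite group_stepE !voteE !ffunE. Qed.

Lemma margin_walk (p : profile (3 * m)) k :
  \sum_v vote k (next_alt k) p v = walk axis (group_axes p) (group_signs p) k.
Proof.
rewrite sum_voters /walk sum_ffunE; apply: eq_bigr => i _; exact: group_voteE.
Qed.

Definition council (c : {ffun 'I_m -> 'I_3 * 'I_3 * 'I_3})
    (b : {ffun 'I_m -> bool * bool * bool}) (k : 'I_3) : int :=
  Num.sg (\sum_i Num.sg (group_step axis (c i) (b i) k)).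

Lemma comparisonE (p : profile (3 * m)) k :
  comparison (vote k (next_alt k) p) = council (group_axes p) (group_signs p) k.
Proof.
by congr Num.sg; apply: eq_bigr => i _; rewrite group_voteE.
Qed.

Lemma next_altE : [/\ next_alt alt_a = alt_b, next_alt alt_b = alt_c & next_alt alt_c = alt_a].
Proof. by rewrite /next_alt !inordK. Qed.

Definition councils_agree c b :=
  (council c b (inord 0) == council c b (inord 1)) &&
  (council c b (inord 1) == council c b (inord 2)).

Lemma in_all_comparisons_agree (p : profile (3 * m)) :
  (p \in all_comparisons_agree m) = councils_agree (group_axes p) (group_signs p).
Proof.
rewrite inE /councils_agree -!comparisonE; have [na nb nc] := next_altE.
by rewrite na nb nc.
Qed.

(* For signs, twice the majority of three is their sum minus their product. *)
Lemma council_walk (c : {ffun 'I_m -> 'I_3 * 'I_3 * 'I_3})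
    (b : {ffun 'I_m -> bool * bool * bool}) k :
  (\sum_i Num.sg (group_step axis (c i) (b i) k)) * 2 =
  walk axis c b k - product_sum c (parities b) k.
Proof.
rewrite /walk sum_ffunE /product_sum -sumrB mulr_suml; apply: eq_bigr => i _.
rewrite group_stepE [parities b i]ffunE /axes_sign !axisE /parity.
case: (c i) => [[x1 x2] x3]; case: (b i) => [[b1 b2] b3] /=.
by case: (k == x1); case: (k == x2); case: (k == x3); case: b1; case: b2; case: b3.
Qed.

End Groups.

(** By [council_walk], twice the sum of majorities is a margin of size at most [t] minus a product
    sum of size above [t], so the latter decides the sign. The common minus sign does not affect
    agreement. *)
Lemma council_small_margin j t (c : {ffun 'I_j.*2.+1 -> 'I_3 * 'I_3 * 'I_3})
    (b : {ffun 'I_j.*2.+1 -> bool * bool * bool}) :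
  box t (walk axis c b) -> ~~ near_tie t c (parities b) ->
  councils_agree c b = all_same c (parities b).
Proof.
move=> /forallP bx; rewrite negb_exists => /forallP nt.
have H k : council c b k = - Num.sg (product_sum c (parities b) k).
  have := bx k; have := nt k; have := council_walk c b k; rewrite /council.
  move: (\sum_i _) (walk axis c b k) (product_sum _ _ _) => x y z E nz ny.
  have [z0|z0|z0] := ltrgt0P z; first by rewrite ltr0_sg ?(gtr0_sg z0) //; lia.
    by rewrite gtr0_sg ?(ltr0_sg z0) //; lia.
  by move: nz; rewrite z0.
by rewrite /councils_agree /all_same !H !eqr_opp.
Qed.

(** * Asymptotics *)

Lemma final_ratio (R : realFieldType) (X Y H e w : R) :
  0 <= w -> w <= 1 / 100%:R -> 1 - 69%:R * w <= X -> Y <= 1 + 100%:R * w -> X <= Y ->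
  0 <= e -> e <= w -> 0 <= H -> H <= 12%:R * w ->
  (Y - X + H * Y + 3%:R * e) / (X - e) <= 800%:R * w.
Proof.
move=> w0 w1 X1 Y1 XY e0 e1 H0 H1.
rewrite ler_pdivrMr; last by lra.
have HY : H * Y <= 12%:R * w * 2.
  by apply: ler_pM => //; lra.
(* The denominator is at least 3/10 and the numerator at most [(169 + 24 + 3) w], which is below
   [800 w / 4]. *)
have : 800%:R * w * (1 / 4) <= 800%:R * w * (X - e).
  by apply: ler_wpM2l; [rewrite mulr_ge0 ?ler0n | lra].
lra.
Qed.

(** * Explicit error of order 1 / log n *)

Section FinalEstimate.
Variables (R : realFieldType) (j T L : nat) (s l d pk : R).
Let m := j.*2.+1.
Hypotheses (s_gt0 : 0 < s) (s2 : s ^+ 2 = m%:R) (l_ge : 100%:R <= l) (s_ge : l ^+ 12 <= s).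
Hypotheses (d_ge : s / l <= d) (d_le : d <= 2 * (s / l)).
Hypotheses (T_le : T%:R <= d) (T_gt : d < T.+1%:R).
Hypotheses (L_le : L%:R <= d / l) (L_gt : d / l < L.+1%:R).
Hypothesis pkE : pk = peak R j.
(** The intended values are [s = sqrt m], [l = ln n] and [d = sqrt n / ln n], with [T] and [L] the
    integer parts of [d] and [d / l]. The smoothing scale [L] is thus a fraction of order [w] of the
    box, yet large enough to make the decoupling error small. *)
Let w := l^-1.
Let t := (T - 18 * L)%N.

Let l0 : 0 < l. Proof. by apply: lt_le_trans l_ge; rewrite ltr0n. Qed.
Let w0 : 0 < w. Proof. by rewrite invr_gt0. Qed.
Let w_le : w <= 1 / 100%:R.
Proof. by rewrite /w div1r lef_pV2 ?posrE ?ltr0n. Qed.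
Let s_w : 1 <= s * w ^+ 12.
Proof. by rewrite /w exprVn ler_pdivlMr ?exprn_gt0 // mul1r. Qed.
Let d_ge' : s * w <= d. Proof. exact: d_ge. Qed.
Let d_le' : d <= 2 * (s * w). Proof. exact: d_le. Qed.

Let wpow k : w ^+ k.+1 <= w ^+ k / 100%:R.
Proof.
by rewrite exprSr ler_wpM2l ?exprn_ge0 ?(ltW w0) // -div1r.
Qed.

Let d_big : 1 <= d * w ^+ 2 / 100%:R.
Proof.
have w9 : w ^+ 12 <= w ^+ 3 / 100%:R.
  rewrite (_ : 12 = 4 + 8)%N // exprD; apply: le_trans (wpow 3).
  by rewrite ler_piMr ?exprn_ge0 ?exprn_ile1 ?(ltW w0) //; move: w_le; lra.
apply: le_trans s_w (le_trans (ler_wpM2l (ltW s_gt0) w9) _).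
have -> : s * (w ^+ 3 / 100%:R) = s * w * w ^+ 2 / 100%:R by ring.
by rewrite ler_wpM2r ?invr_ge0 ?ler0n // ler_wpM2r ?exprn_ge0 ?(ltW w0).
Qed.

Let d0 : 0 < d. Proof. by apply: lt_le_trans d_ge'; rewrite mulr_gt0. Qed.
Let dw0 : 0 < d * w. Proof. exact: mulr_gt0. Qed.

Let one_le : 1 <= d * w / 100%:R.
Proof.
apply: le_trans d_big _; rewrite ler_wpM2r ?invr_ge0 ?ler0n // ler_wpM2l ?(ltW d0) //.
by rewrite expr2 ler_piMr ?(ltW w0) //; move: w_le; lra.
Qed.

Let dw_le : d * w <= d / 100%:R.
Proof. by rewrite ler_wpM2l ?(ltW d0) // -div1r. Qed.

Let L_le' : L%:R <= d * w. Proof. exact: L_le. Qed.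
Let T_gt' : d < T%:R + 1. Proof. by rewrite natr1. Qed.
Let L_gt' : d * w < L%:R + 1. Proof. by rewrite natr1. Qed.
Let L_ge' : d * w / 2 <= L%:R.
Proof. move: L_gt' one_le dw0; lra. Qed.

Let L_gt0 : (0 < L)%N.
Proof. by rewrite -(ltr0n R); apply: lt_le_trans L_ge'; rewrite divr_gt0. Qed.

Let le_LT : (18 * L <= T)%N.
Proof.
by rewrite -(ler_nat R) natrM; move: T_gt' L_le' one_le dw0 dw_le d0; lra.
Qed.

Let t_ge : d * (1 - 22%:R * w) <= t%:R - 3%:R.
Proof.
rewrite /t natrB // natrM; move: T_gt' L_le' one_le dw0; rewrite mulrBr mulr1 mulrCA; lra.
Qed.

Let t_le : t%:R <= d.
Proof. by apply: le_trans T_le; rewrite ler_nat leq_subr. Qed.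

Let t_ge3 : (3 <= t)%N.
Proof.
rewrite -(ler_nat R) -subr_ge0; apply: le_trans t_ge; rewrite mulr_ge0 ?(ltW d0) //.
move: w_le; lra.
Qed.

Let d2 : d ^+ 2 / (2 * m%:R) <= w.
Proof.
rewrite -s2 ler_pdivrMr ?mulr_gt0 ?exprn_gt0 //.
apply: le_trans (_ : (2 * (s * w)) ^+ 2 <= _); first by rewrite ler_pXn2r ?nnegrE ?mulr_ge0 ?(ltW s_gt0) ?(ltW w0) ?(ltW d0).
have -> : (2 * (s * w)) ^+ 2 = (2 * w) * (w * (2 * s ^+ 2)) by ring.
rewrite ler_piMl ?mulr_ge0 ?exprn_ge0 ?(ltW w0) ?(ltW s_gt0) //; move: w_le; lra.
Qed.

Let t_le_m : (t <= m)%N.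
Proof.
rewrite -(ler_nat R) -s2; apply: le_trans t_le (le_trans d_le' _).
rewrite expr2 mulrCA ler_wpM2l ?(ltW s_gt0) //.
apply: le_trans (_ : 1 <= _); first by move: w_le; lra.
apply: le_trans s_w _; rewrite ler_piMr ?exprn_ile1 ?(ltW s_gt0) ?(ltW w0) //; move: w_le; lra.
Qed.

Let pk0 : 0 < pk. Proof. by rewrite pkE peak_gt0. Qed.

Let pk_le : s * pk <= 1.
Proof.
rewrite -(@expr_le1 _ 2) ?mulr_ge0 ?(ltW s_gt0) ?(ltW pk0) //.
by rewrite exprMn s2 pkE; apply: peak_sqr_le.
Qed.

Let pk_ge : 1 <= 3%:R * s * pk.
Proof.
rewrite -(@expr_ge1 _ 2) ?mulr_ge0 ?(ltW s_gt0) ?(ltW pk0) //.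
rewrite !exprMn s2; apply: le_trans (peak_sqr_ge R j) _; rewrite -pkE.
rewrite ler_wpM2r ?exprn_ge0 ?(ltW pk0) // ler_wpM2r ?ler0n //.
by rewrite -natrX ler_nat.
Qed.

(** This is the main term of the probability of closeness: about [d ^+ 3 / 4] endpoints, each of
    weight about [pk ^+ 3]. *)
Let vol := pk ^+ 3 * (d ^+ 3 / 4).

Let vol0 : 0 < vol.
Proof. by rewrite !mulr_gt0 ?invr_gt0 ?exprn_gt0. Qed.

Let y := pk ^+ 3 * ((T + 18 * L + 2)%:R ^+ 3 / 4).
Let x := (pk * (1 - (t ^ 2)%:R / (2 * m%:R))) ^+ 3 * ((t - 3)%:R ^+ 3 / 4).

Let y_le : y <= vol * (1 + 100%:R * w).
Proof.
have -> : vol * (1 + 100%:R * w) = pk ^+ 3 * ((d ^+ 3 * (1 + 100%:R * w)) / 4) by rewrite /vol; ring.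
rewrite ler_wpM2l ?exprn_ge0 ?(ltW pk0) // ler_wpM2r ?invr_ge0 ?ler0n //.
(* [18 L] costs [18 d w] and the constant 2 less than another [2 d w]. *)
apply: le_trans (_ : (d * (1 + 20%:R * w)) ^+ 3 <= _).
  rewrite ler_pXn2r ?nnegrE ?ler0n ?mulr_ge0 ?(ltW d0) //; last by move: w0; lra.
  rewrite natrD natrD natrM; move: T_le L_le' one_le dw0; rewrite mulrDr mulr1 mulrCA; lra.
rewrite exprMn ler_wpM2l ?exprn_ge0 ?(ltW d0) //.
have w2 : w * w <= w / 100%:R by rewrite ler_wpM2l ?(ltW w0) // -div1r.
have : w * w * w <= w * w / 100%:R by rewrite ler_wpM2l ?mulr_ge0 ?(ltW w0) // -div1r.
move: w0 w_le w2; rewrite !exprS expr0; lra.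
Qed.

Let x_ge : vol * (1 - 69%:R * w) <= x.
Proof.
have -> : vol * (1 - 69%:R * w) = pk ^+ 3 * ((d ^+ 3 * (1 - 69%:R * w)) / 4) by rewrite /vol; ring.
have -> : x = pk ^+ 3 * (((1 - (t ^ 2)%:R / (2 * m%:R)) * (t - 3)%:R) ^+ 3 / 4).
  by rewrite /x !exprMn; ring.
rewrite ler_wpM2l ?exprn_ge0 ?(ltW pk0) // ler_wpM2r ?invr_ge0 ?ler0n //.
(* The side loses [22 w] relatively and the binomial weight [w]; cubing at most triples the total
   loss. *)
apply: le_trans (_ : (d * (1 - 23%:R * w)) ^+ 3 <= _).
  rewrite exprMn ler_wpM2l ?exprn_ge0 ?(ltW d0) //.
  have -> : (1 - 23%:R * w) ^+ 3 = 1 - 69%:R * w + w * w * (529%:R * (3%:R - 23%:R * w)) by ring.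
  have : 0 <= 3%:R - 23%:R * w by move: w_le; lra.
  by move=> w3; rewrite lerDl !mulr_ge0 ?ler0n ?(ltW w0).
have q1 : 1 - w <= 1 - (t ^ 2)%:R / (2 * m%:R).
  rewrite lerB //; apply: le_trans d2; rewrite ler_wpM2r ?invr_ge0 ?mulr_ge0 ?ler0n //.
  by rewrite natrX ler_sqr ?nnegrE ?ler0n ?(ltW d0).
have q0 : 0 <= 1 - w by move: w_le; lra.
have q2 : d * (1 - 22%:R * w) <= (t - 3)%:R by rewrite natrB.
have q3 : 0 <= d * (1 - 22%:R * w) by rewrite mulr_ge0 ?(ltW d0) //; move: w_le; lra.
have q4 : 0 <= d * (1 - 23%:R * w) by rewrite mulr_ge0 ?(ltW d0) //; move: w_le; lra.
have q5 := mulr_ge0 (le_trans q0 q1) (ler0n R (t - 3)).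
rewrite ler_pXn2r ?nnegrE //.
apply: le_trans (ler_pM q0 q3 q1 q2).
have -> : (1 - w) * (d * (1 - 22%:R * w)) = d * (1 - 23%:R * w) + 22%:R * (d * w * w) by ring.
by rewrite lerDl !mulr_ge0 ?ler0n ?(ltW d0) ?(ltW w0).
Qed.

Let eta := decoupling_error m L s.

(** Since [L] is at least [s w^2 / 2], the error is at most [88 / (s w^6)], while [vol] is at least
    [w^3 / 108]; the hypothesis that [s] is at least [l ^+ 12] then suffices. *)
Let eta_le : eta <= vol * w.
Proof.
have Lr0 : 0 < L%:R :> R by rewrite ltr0n.
have L1 : s * w ^+ 2 / 2 <= L%:R.
  apply: le_trans L_ge'; rewrite ler_wpM2r ?invr_ge0 ?ler0n //.
  by rewrite expr2 mulrA ler_wpM2r ?(ltW w0).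
have sw0 : 0 < s * w ^+ 2 / 2 by rewrite divr_gt0 ?mulr_gt0 ?exprn_gt0.
have e1 : m%:R * (8 / L%:R ^+ 3) <= 64%:R / (s * w ^+ 6).
  apply: le_trans (_ : m%:R * (8 / (s * w ^+ 2 / 2) ^+ 3) <= _).
    rewrite ler_wpM2l ?ler0n // ler_wpM2l ?ler0n // lef_pV2 ?posrE ?exprn_gt0 //.
    by rewrite ler_pXn2r ?nnegrE ?(ltW sw0) ?ler0n.
  rewrite -s2 le_eqVlt; apply/orP; left; apply/eqP; field.
  by rewrite gt_eqF //= gt_eqF.
have e2 : 3 * s * (2 / L%:R ^+ 2) <= 24%:R / (s * w ^+ 4).
  apply: le_trans (_ : 3 * s * (2 / (s * w ^+ 2 / 2) ^+ 2) <= _).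
    rewrite ler_wpM2l ?mulr_ge0 ?ler0n ?(ltW s_gt0) // ler_wpM2l ?ler0n // lef_pV2 ?posrE ?exprn_gt0 //.
    by rewrite ler_pXn2r ?nnegrE ?(ltW sw0) ?ler0n.
  rewrite le_eqVlt; apply/orP; left; apply/eqP; field.
  by rewrite gt_eqF //= gt_eqF.
have e3 : 24%:R / (s * w ^+ 4) <= 24%:R / (s * w ^+ 6).
  rewrite ler_wpM2l ?ler0n // lef_pV2 ?posrE ?mulr_gt0 ?exprn_gt0 //.
  rewrite ler_wpM2l ?(ltW s_gt0) // (exprD w 4 2) ler_piMr ?exprn_ge0 ?exprn_ile1 ?(ltW w0) //.
  by move: w_le; lra.
have v1 : w ^+ 3 / 108%:R <= vol.
  have -> : w ^+ 3 / 108%:R = (w / 3%:R) ^+ 3 / 4 by field.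
  have -> : vol = (pk * d) ^+ 3 / 4 by rewrite /vol exprMn; ring.
  rewrite ler_wpM2r ?invr_ge0 ?ler0n // ler_pXn2r ?nnegrE ?divr_ge0 ?mulr_ge0 ?ler0n ?(ltW w0) ?(ltW d0) ?(ltW pk0) //.
  apply: le_trans (ler_wpM2l (ltW pk0) d_ge').
  rewrite ler_pdivrMr ?ltr0n //.
  have -> : pk * (s * w) * 3%:R = 3%:R * s * pk * w by ring.
  by rewrite ler_peMl ?(ltW w0).
apply: le_trans (_ : 88%:R / (s * w ^+ 6) <= _).
  rewrite /eta /decoupling_error; move: e1 e2 e3.
  have -> : 88%:R / (s * w ^+ 6) = 64%:R / (s * w ^+ 6) + 24%:R / (s * w ^+ 6) by rewrite -mulrDl; congr (_ / _); ring.
  lra.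
apply: le_trans (ler_wpM2r (ltW w0) v1).
rewrite ler_pdivrMr ?mulr_gt0 ?exprn_gt0 //.
have -> : w ^+ 3 / 108%:R * w * (s * w ^+ 6) = s * w ^+ 10 / 108%:R by ring.
rewrite ler_pdivlMr ?ltr0n //.
(* Two factors [w] give 10000, which exceeds 88 * 108 = 9504. *)
have : w ^+ 12 <= w ^+ 10 / 100%:R / 100%:R.
  by apply: le_trans (wpow 11) _; rewrite ler_wpM2r ?invr_ge0 ?ler0n.
move=> /(ler_wpM2l (ltW s_gt0)) /(le_trans s_w).
have -> : s * (w ^+ 10 / 100%:R / 100%:R) = s * w ^+ 10 / (100%:R * 100%:R) by field.
rewrite ler_pdivlMr ?mulr_gt0 ?ltr0n // mul1r; apply: le_trans.
by rewrite -!natrM ler_nat.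
Qed.

Let eta_ge0 : 0 <= eta.
Proof.
by rewrite addr_ge0 // !mulr_ge0 ?invr_ge0 ?exprn_ge0 ?ler0n // ltW.
Qed.

Let H := 3%:R * (T.+1%:R * pk).

Let H_le : H <= 12%:R * w.
Proof.
have T2 : T.+1%:R <= 4 * s * w.
  rewrite -[T.+1%:R]natr1; move: T_le one_le dw_le d_le' d0; rewrite mulrA; lra.
have -> : 12%:R * w = 3%:R * (4 * w) by ring.
rewrite ler_wpM2l ?ler0n //; apply: le_trans (ler_wpM2r (ltW pk0) T2) _.
have -> : 4 * s * w * pk = 4 * w * (s * pk) by ring.
by rewrite ler_piMr ?mulr_ge0 ?(ltW w0).
Qed.

Let XS := {ffun 'I_j.*2.+1 -> 'I_3 * 'I_3 * 'I_3}.
Let BS := {ffun 'I_j.*2.+1 -> bool * bool * bool}.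

Lemma final_estimate (agree : XS -> BS -> bool) :
  (forall (c : XS) (b : BS), box T (walk axis c b) -> ~~ near_tie T c (parities b) ->
     agree c b = all_same c (parities b)) ->
  `|expect (fun (c : XS) (b : BS) => (agree c b)%:R * (box T (walk axis c b))%:R : R) /
      expect (fun (c : XS) (b : BS) => (box T (walk axis c b))%:R : R)
    - (1 - 3%:R * arcsin_sum (1 / 27%:R) j) / 4| <= 800%:R / l.
Proof.
move=> agreeE.
have xm : x <= mean_walk m (fun v => (box t v)%:R).
  by rewrite /x pkE; apply: mean_walk_box_ge; rewrite t_ge3.
have ym := mean_walk_box_le R j (T + 18 * L); rewrite -pkE in ym.
have xvol : 0 < vol * (1 - 70%:R * w).
  by rewrite mulr_gt0 //; move: w_le; lra.
have eta_x : eta < x.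
  by move: x_ge eta_le xvol; rewrite !mulrBr !mulr1 ![vol * (_ * w)]mulrCA; lra.
have x0 : 0 <= x by exact: le_trans eta_ge0 (ltW eta_x).
apply: le_trans (conditional_bound L_gt0 s_gt0 s2 le_LT ym xm x0 eta_x agreeE) _.
rewrite -pkE -/y -/eta -/H.
have -> : (y - x + H * y + 3%:R * eta) / (x - eta) =
   (y / vol - x / vol + H * (y / vol) + 3%:R * (eta / vol)) / (x / vol - eta / vol).
  by field; rewrite !gt_eqF // ?subr_gt0 // -mulrBl divr_gt0 // subr_gt0.
have xy : x <= y.
  apply: le_trans xm (le_trans _ ym); apply: opAs_le => v; rewrite ler_nat.
  case: (boolP (box t v)) => // /forallP bv; rewrite lt0b; apply/forallP => k.
  exact: leq_trans (bv k) (leq_trans (leq_subr _ _) (leq_addr _ _)).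
apply: final_ratio.
- exact: ltW.
- exact: w_le.
- by rewrite ler_pdivlMr // mulrC.
- by rewrite ler_pdivrMr // mulrC.
- by rewrite ler_wpM2r // invr_ge0 ltW.
- by rewrite divr_ge0 // ltW.
- by rewrite ler_pdivrMr // mulrC.
- by rewrite /H mulr_ge0 ?ler0n // mulr_ge0 ?ler0n // ltW.
- exact: H_le.
Qed.

End FinalEstimate.

Local Open Scope classical_set_scope.
Local Open Scope ring_scope.

(** * Translation of the probabilities and passage to the limit *)

Section Asymptotics.
Variable R : realType.

Lemma close_pairE m (d : R) k (p : profile (3 * m)) : 0 <= d ->
  close_pair d k (next_alt k) p =
  (absz (walk axis (group_axes p) (group_signs p) k) <= Num.truncn d)%N.
Proof.
move=> d_ge0; rewrite /close_pair margin_walk truncn_ge_nat //.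
by rewrite -intr_norm -abszE.
Qed.

Lemma in_close_election m (d : R) (p : profile (3 * m)) : 0 <= d ->
  (p \in close_election (3 * m) d) =
  box (Num.truncn d) (walk axis (group_axes p) (group_signs p)).
Proof.
move=> d_ge0; rewrite inE /box forall3 -!close_pairE //.
by have [na nb nc] := next_altE; rewrite na nb nc.
Qed.

(** By [groups_bij], the uniform law on profiles is the uniform law on axes and signs. *)
Lemma Pr_expect j (A : {set profile (3 * j.*2.+1)}) F :
  (forall p, (p \in A) = F (group_axes p) (group_signs p)) ->
  Pr R A = expect (fun c b => (F c b)%:R).
Proof.
move=> AF.
have -> : Pr R A = avg (fun p => (p \in A)%:R).
  rewrite /Pr /avg card_ffun card_ord card_ranking natrX mulr_suml.
  rewrite big_mkcond; apply: eq_bigr => p _.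
  rewrite prodr_const card_ord exprVn.
  by case: (p \in A); rewrite ?mul1r ?mul0r.
rewrite /expect -(avg_pair (fun cb => (F cb.1 cb.2)%:R)).
rewrite -(reindex_avg _ (groups_bij j.*2.+1)).
by apply: eq_avg => p; rewrite AF.
Qed.

Lemma condPr_expect j (d : R) : 0 <= d ->
  condPr R (all_comparisons_agree j.*2.+1) (close_election (3 * j.*2.+1) d) =
  expect (j := j) (fun c b => (councils_agree c b)%:R * (box (Num.truncn d) (walk axis c b))%:R) /
  expect (j := j) (fun c b => (box (Num.truncn d) (walk axis c b))%:R).
Proof.
move=> d_ge0; rewrite /condPr; congr (_ / _); last first.
  by apply: Pr_expect => p; apply: in_close_election.
rewrite (Pr_expect (F := fun c b => councils_agree c b && box (Num.truncn d) (walk axis c b))).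
  by apply: eq_expect => c b; rewrite -mulnb natrM.
by move=> p; rewrite inE in_all_comparisons_agree in_close_election.
Qed.

(** At [l = ln (3 m)] this reads [l ^+ 24 <= m], that is [l ^+ 12 <= sqrt m], as [final_estimate]
    requires. It follows from the Taylor term of degree 25. *)
Lemma expR_dominates : exists K : R, forall l, K <= l ->
  100%:R <= l /\ 3%:R * l ^+ 24 <= expR l.
Proof.
have [F [F0 HF]] : exists F : R, 0 < F /\ forall l, 0 <= l -> l ^+ 25 / F <= expR l.
  have [n ->] : exists n, (25 = n.+1)%N by exists 24.
  exists (n.+1)`!%:R; split; first by rewrite ltr0n fact_gt0.
  by move=> l l0; apply: le_trans (expR_ge1Dxn n l0); rewrite lerDr.
exists (100%:R + 3%:R * F) => l Kl.
have F3 : 0 < 3%:R * F by rewrite mulr_gt0.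
have l100 : 100%:R <= l by apply: le_trans Kl; rewrite lerDl ltW.
have l0 : 0 <= l by apply: le_trans l100; rewrite ler0n.
split=> //; apply: le_trans (HF _ l0).
rewrite ler_pdivlMr // mulrAC [l ^+ 25]exprSr mulrC ler_wpM2l ?exprn_ge0 //.
by apply: le_trans Kl; rewrite lerDr ler0n.
Qed.

Lemma condPr_bound : exists K : R, forall j, K <= ln (3 * j.*2.+1)%:R ->
  `|condPr R (all_comparisons_agree j.*2.+1)
      (close_election (3 * j.*2.+1) (closeness R (3 * j.*2.+1)))
    - (1 - 3%:R * arcsin_sum (1 / 27%:R) j) / 4| <= 800%:R / ln (3 * j.*2.+1)%:R.
Proof.
have [K HK] := expR_dominates; exists K => j Kl.
set m := j.*2.+1; set l := ln (3 * m)%:R in Kl *.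
have [l100 l24] := HK l Kl.
have l0 : 0 < l by apply: lt_le_trans l100; rewrite ltr0n.
have n0 : 0 < (3 * m)%:R :> R by rewrite ltr0n.
rewrite lnK ?posrE // natrM ler_pM2l ?ltr0n // in l24.
pose s : R := Num.sqrt m%:R; have s0 : 0 < s by rewrite sqrtr_gt0 ltr0n.
have s2 : s ^+ 2 = m%:R by rewrite sqr_sqrtr ?ler0n.
have ls : l ^+ 12 <= s.
  rewrite -(@ler_pXn2r _ 2) ?nnegrE ?exprn_ge0 ?(ltW l0) ?(ltW s0) //.
  by rewrite s2 -exprM.
set d := closeness R (3 * m).
have dE : d = Num.sqrt (3 * m)%:R / l by [].
have d_ge : s / l <= d.
  rewrite dE ler_wpM2r ?invr_ge0 ?(ltW l0) // ler_sqrt ?ler0n //.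
  by rewrite ler_nat leq_pmull.
have d_le : d <= 2 * (s / l).
  rewrite dE mulrA ler_wpM2r ?invr_ge0 ?(ltW l0) //.
  have -> : 2 * s = Num.sqrt (4 * m)%:R.
    have e4 : 4%:R = 2 ^+ 2 :> R by rewrite -natrX.
    by rewrite natrM sqrtrM ?ler0n // e4 sqrtr_sqr ger0_norm.
  by rewrite ler_sqrt ?ler0n // ler_nat leq_mul2r orbT.
have d0 : 0 <= d by apply: le_trans d_ge; rewrite divr_ge0 ?(ltW l0) ?(ltW s0).
have dl0 : 0 <= d / l by rewrite divr_ge0 // ltW.
have /andP[T1 T2] := truncn_itv d0; have /andP[L1 L2] := truncn_itv dl0.
rewrite condPr_expect //.
apply: (final_estimate s0 s2 l100 ls d_ge d_le T1 T2 L1 L2 (erefl (peak R j))).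
by move=> c b; apply: council_small_margin.
Qed.

(** The sum corrected by [q ^+ (2j)] is decreasing and nonnegative, hence convergent, and the
    correction tends to 0. *)
Lemma arcsin_sum_cvg : exists g : R,
  [/\ arcsin_sum (1 / 27%:R) j @[j --> \oo] --> g,
      1 / 27%:R * (81 / 128) <= g & g <= 1 / 27%:R * (66 / 100) + 2 * (1 / 27%:R) ^+ 3].
Proof.
set q : R := 1 / 27%:R; have q0 : 0 < q by rewrite /q divr_gt0 ?ltr0n.
have q1 : q <= 1 / 2 by rewrite /q; lra.
pose u j := arcsin_sum q j + (q ^+ 2) ^+ j.
have u_decr : {homo u : n m / (n <= m)%N >-> m <= n}.
  apply/nonincreasing_seqP => n; have := arcsin_sum_decr q0 q1 n.
  by rewrite /u -!exprM !mul2n.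
have u_cvg : cvgn u.
  apply: nonincreasing_is_cvgn => //; exists 0 => _ [n _ <-].
  by rewrite addr_ge0 ?exprn_ge0 ?(ltW q0) // arcsin_sum_ge0.
have q2 : `|q ^+ 2| < 1.
  by rewrite ger0_norm ?exprn_ge0 ?(ltW q0) // exprn_ilt1 ?(ltW q0) //; apply: le_lt_trans q1 _; lra.
have s_cvg : arcsin_sum q j @[j --> \oo] --> limn u.
  have -> : arcsin_sum q = (fun j => u j - (q ^+ 2) ^+ j) by apply/funext => j; rewrite /u addrK.
  rewrite -[limn u]subr0; apply: cvgB => //; exact: cvg_expr.
exists (limn u); split=> //.
  rewrite -(cvg_lim _ s_cvg) //; apply: limr_ge; first by apply: cvgP s_cvg.
  by exists 2%N => // j /= j2; apply: arcsin_sum_ge.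
rewrite -(cvg_lim _ s_cvg) //; apply: limr_le; first by apply: cvgP s_cvg.
by exists 8%N => // j /= j8; apply: arcsin_sum_le.
Qed.

End Asymptotics.

Theorem theorem1p5 (R : realType) :
  exists alpha : R,
    `|alpha - 232%:R / 1000%:R| < 1 / 2000%:R /\
    condPr R (all_comparisons_agree m)
      (close_election (3 * m) (closeness R (3 * m)))
      @[m --> within [set m : nat | odd m] \oo] --> alpha.
Proof.
have [g [g_cvg g_ge g_le]] := arcsin_sum_cvg R.
exists ((1 - 3%:R * g) / 4); split.
  (* The bounds on [g] place the limit strictly between 0.2315 and 0.2325. *)
  by rewrite ltr_norml; apply/andP; split; lra.
have [K HK] := condPr_bound R.
have a_cvg : (1 - 3%:R * arcsin_sum (1 / 27%:R) j) / 4 @[j --> \oo] --> (1 - 3%:R * g) / 4.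
  by apply: cvgM (cvg_cst _); apply: cvgB (cvg_cst _) _; apply: cvgM (cvg_cst _) g_cvg.
apply/cvgrPdist_lt => e e0.
have e2 : 0 < e / 2 by rewrite divr_gt0.
have /cvgrPdist_lt/(_ _ e2)[N _ HN] := a_cvg.
pose K' := Num.max K (Num.max 1 (2 * 900%:R / e)).
exists (maxn N.*2.+1 (Num.truncn (expR K')).+1) => // m /=.
rewrite geq_max => /andP[Nm Km] m_odd.
have mE : m = (m./2).*2.+1 by rewrite -[LHS]odd_double_half m_odd.
have Kl : K' <= ln (3 * m)%:R.
  rewrite -[K']expRK ler_ln ?posrE ?expR_gt0 ?ltr0n //; last by lia.
  apply/ltW/(lt_le_trans (_ : _ < (Num.truncn (expR K')).+1%:R)).
    by have /andP[] := truncn_itv (ltW (expR_gt0 K')).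
  by rewrite ler_nat; lia.
have [Kl1 Kl2 Kl3] : [/\ K <= ln ((3 * m)%:R : R), 1 <= ln ((3 * m)%:R : R) &
    2 * 900%:R / e <= ln ((3 * m)%:R : R)].
  by move: Kl; rewrite /K' !ge_max => /and3P[].
have l0 : 0 < ln ((3 * m)%:R : R) by apply: lt_le_trans Kl2.
have B := HK (m./2); rewrite -mE in B; have {}B := B Kl1.
have Nm2 : (N <= m./2)%N by clear -Nm; lia.
have A := HN (m./2) Nm2.
have C : 800%:R / ln ((3 * m)%:R : R) < e / 2.
  rewrite ltr_pdivrMr //; rewrite ler_pdivrMr // in Kl3.
  by move: Kl3; move: (ln _) => l; clear; lra.
rewrite [e]splitr -(subrKA ((1 - 3%:R * arcsin_sum (1 / 27%:R) m./2) / 4)).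
apply: le_lt_trans (ler_normD _ _) (ltrD A _).
by rewrite distrC; apply: le_lt_trans B C.
Qed.
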